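(* Let $u\in BV(I)$ be a solution of $u_t=(\mathcal L(u_x))_x$ which is time independent (a steady state), i.e. $u$ satisfies $(\mathcal L(u_x))_x=0$ in $(a,b)$. (a) If $\mathcal L(u_x)=0$ at $x=a$ and $x=b$, then $|u_x|\le1$. That is, any Lipschitz function with Lipschitz constant not exceeding $1$ is a steady state with homogeneous Neumann boundary conditions. (b) If $u$ is a steady state with Dirichlet data $A$ at $a$ and $B$ at $b$, and $A\le B$ (the case $B\le A$ is analogous), then: (i) if $(B-A)/(b-a)>1$, then any increasing function satisfying the data with $u_x\ge1$ is a steady state; (ii) if $(B-A)/(b-a)=1$, then $u(x)=x+A-a$ is the only steady state; (iii) if $(B-A)/(b-a)<1$, then any Lipschitz continuous function with $|u_x|\le1$ satisfying $u(a)=A$, $u(b)=B$ is a steady state with these Dirichlet data. (c) If $u$ satisfies the periodic boundary condition $u(a)=u(b)$, then $u$ is a periodic Lipschitz continuous function with $|u_x|\le1$.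
   Context: Fix reals $a<b$, $I=(a,b)$. $\operatorname{sgn}$ is the multivalued sign graph ($1$ for $p>0$, $-1$ for $p<0$, $[-1,1]$ at $p=0$), $\mathcal L(p)=\operatorname{sgn}(p+1)+\operatorname{sgn}(p-1)$, $W(p)=|p+1|+|p-1|$. For $v\in BV(I)$, $\int_I W(Dv):=|D(v+x)|(I)+|D(v-x)|(I)$. $\gamma$ denotes the trace (one-sided limit from inside $I$ at an endpoint). Steady state: $u\in BV(I)$ such that there is $\Omega\in W^{1,2}(I)$ (denoted also $\mathcal L(u_x)$) with $\Omega_x=0$ in $I$, where $\Omega$ is a selection of $\mathcal L\circ u_x$, understood in the subdifferential sense: $\int_I W(Dv)\ge\int_I W(Du)+\int_I\Omega\,d(Dv-Du)$ for all $v\in BV(I)$; and $(u,\Omega)$ satisfies the boundary condition under consideration. Boundary conditions. Homogeneous Neumann: $\gamma\Omega(a)=\gamma\Omega(b)=0$. Dirichlet data $A,B\in\mathbb R$: at $x=a$ either $\gamma u(a)=A$, or $\gamma u(a)>A$ and $\gamma\Omega(a)=2$, or $\gamma u(a)<A$ and $\gamma\Omega(a)=-2$; at $x=b$ either $\gamma u(b)=B$, or $\gamma u(b)>B$ and $\gamma\Omega(b)=-2$, or $\gamma u(b)<B$ and $\gamma\Omega(b)=2$. (For an increasing function with $u_x\ge1$, with $\Omega\equiv2$, satisfying the Dirichlet data means $\gamma u(a)\ge A$ and $\gamma u(b)\le B$.) Periodic: $u(a)=u(b)$, in the sense of traces. For an increasing, possibly discontinuous, function, $u_x\ge1$ means that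 $u(x)-x$ is nondecreasing. The analogous case $B\le A$ of (b) is the one obtained by replacing $u,A,B$ by $-u,-A,-B$. *)

(* Defs.v *)
From HB Require Import structures.
From mathcomp Require Import all_boot all_order all_algebra.
From mathcomp Require Import all_classical all_reals all_analysis.

Set Implicit Arguments.
Unset Strict Implicit.
Unset Printing Implicit Defensive.

Import Order.TTheory GRing.Theory Num.Theory.
Import numFieldNormedType.Exports.

Local Open Scope classical_set_scope.
Local Open Scope ring_scope.

(* Integration against a charge.  [hahn_pos] and [hahn_neg] are one chosen Hahn
   decomposition; by [Hahn_decomposition_uniq] the choice does not affect the
   Jordan parts. *)

Section charge_integral.
Context d (T : measurableType d) (R : realType).
Variable nu : {charge set T -> \bar R}.

Definition hahn_pos : set T := projT1 (cid (Hahn_decomposition nu)).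

Definition hahn_neg : set T :=
  projT1 (cid (projT2 (cid (Hahn_decomposition nu)))).

Lemma hahn_posneg : hahn_decomposition nu hahn_pos hahn_neg.
Proof. exact: projT2 (cid (projT2 (cid (Hahn_decomposition nu)))). Qed.

(* |nu|(D) *)
Definition tvar (D : set T) : \bar R := charge_variation hahn_posneg D.

Definition charge_int (D : set T) (f : T -> R) : \bar R :=
  (\int[jordan_pos hahn_posneg]_(x in D) (f x)%:E
   - \int[jordan_neg hahn_posneg]_(x in D) (f x)%:E)%E.

End charge_integral.

(* A class of functions on I = ]a, b[ modulo equality a.e. is represented by any
   Borel function in it; values outside I are irrelevant. *)

Section interval.
Context {R : realType}.
Variables a b : R.

Notation I := (`]a, b[%classic : set (measurableTypeR R)).
Notation lambda := (@lebesgue_measure R).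
Notation rcharge := (charge (measurableTypeR R) R).

(* C^1_c(I) *)
Definition test_fun (phi : R -> R) : Prop :=
  [/\ forall x, derivable phi x 1, continuous (derive1 phi) &
      exists c d, [/\ a < c, d < b & forall x, phi x != 0 -> c <= x <= d]].

Definition L1 (u : R -> R) : Prop := lambda.-integrable I (EFin \o u).

Definition L2 (u : R -> R) : Prop :=
  measurable_fun I u /\ lambda.-integrable I (fun x => (u x ^+ 2)%:E).

Definition weak_deriv (u g : R -> R) : Prop :=
  forall phi, test_fun phi ->
    (\int[lambda]_(x in I) (u x * derive1 phi x)%:E
     = - \int[lambda]_(x in I) (g x * phi x)%:E)%E.

(* The distributional derivative of u on I is the signed measure mu.  Only the
   values of mu on Borel subsets of I are meaningful. *)
Definition measure_deriv (u : R -> R) (mu : rcharge) : Prop :=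
  forall phi, test_fun phi ->
    (\int[lambda]_(x in I) (u x * derive1 phi x)%:E = - charge_int mu I phi)%E.

Definition BV (u : R -> R) : Prop := L1 u /\ exists mu, measure_deriv u mu.

(* The measure Du, with a dummy value when u has none. *)
Definition Dmeas (u : R -> R) : rcharge :=
  if pselect (exists mu, measure_deriv u mu) is left h then projT1 (cid h)
  else czero.

(* The integral of W(Dv) over I, for W(p) = |p + 1| + |p - 1|. *)
Definition intW (v : R -> R) : \bar R :=
  (tvar (Dmeas (fun x => (v x + x)%R)) I + tvar (Dmeas (fun x => (v x - x)%R)) I)%E.

(* W^{1,2}(I), each element being given by its continuous representative: the
   integrals of Omega against D v need it, since D v may have atoms. *)
Definition W12 (Omega : R -> R) : Prop :=
  [/\ {in `]a, b[, continuous Omega}, L2 Omega &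
      exists2 g, L2 g & weak_deriv Omega g].

Definition selection (u Omega : R -> R) : Prop :=
  forall v, BV v ->
    (intW u + charge_int (cadd (Dmeas v) (copp (Dmeas u))) I Omega
     <= intW v)%E.

(* One-sided limit along F (a^'+ or b^'-) of a representative of u. *)
Definition trace (u : R -> R) (F : set_system R) (l : R) : Prop :=
  exists2 w : R -> R,
    \forall x \ae lambda, I x -> u x = w x & w x @[x --> F] --> l.

Definition neumann (u Omega : R -> R) : Prop :=
  trace Omega a^'+ 0 /\ trace Omega b^'- 0.

Definition dirichlet (A B : R) (u Omega : R -> R) : Prop :=
  exists ua ub oa ob : R,
    [/\ [/\ trace u a^'+ ua, trace u b^'- ub,
            trace Omega a^'+ oa & trace Omega b^'- ob],
        [\/ ua = A, A < ua /\ oa = 2 | ua < A /\ oa = - 2] &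
        [\/ ub = B, B < ub /\ ob = - 2 | ub < B /\ ob = 2]].

Definition periodic_bc (u Omega : R -> R) : Prop :=
  exists2 l : R, trace u a^'+ l & trace u b^'- l.

Definition steady_state (bc : (R -> R) -> (R -> R) -> Prop) (u : R -> R) : Prop :=
  BV u /\
  exists Omega, [/\ W12 Omega, weak_deriv Omega (fun=> 0),
                    selection u Omega & bc u Omega].

(* |u_x| <= 1, where u_x is the weak derivative. *)
Definition slope_le1 (u : R -> R) : Prop :=
  exists g, [/\ L1 g, weak_deriv u g & \forall x \ae lambda, I x -> `|g x| <= 1].

(* u_x >= 1 for an increasing, possibly discontinuous, function *)
Definition increasing_slope_ge1 (w : R -> R) : Prop :=
  {in `]a, b[ &, {homo w : x y / x < y}} /\
  {in `]a, b[ &, {homo (fun x => w x - x) : x y / x <= y}}.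

(* The class of u contains a function with property P. *)
Definition has_version (P : (R -> R) -> Prop) (u : R -> R) : Prop :=
  measurable_fun I u /\
  exists2 w : R -> R, P w & \forall x \ae lambda, I x -> u x = w x.

Definition lipschitz_const (k : R) (w : R -> R) : Prop := k.-lipschitz_I w.

(* A Lipschitz function on the circle obtained by identifying a and b. *)
Definition periodic_lipschitz_const (k : R) (w : R -> R) : Prop :=
  (forall x, w (x + (b - a)) = w x) /\ k.-lipschitz w.

End interval.

(* Main.v *)
Require Import Defs.
From HB Require Import structures.
From mathcomp Require Import all_boot all_order all_algebra.
From mathcomp Require Import all_classical all_reals all_analysis.
From mathcomp Require Import measurable_realfun ring lra.
Import Order.TTheory GRing.Theory Num.Theory.
Import numFieldNormedType.Exports.
Local Open Scope classical_set_scope.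
Local Open Scope ring_scope.

(** By Fubini and the du Bois-Reymond lemma, [Dv = mu] on [I = ]a, b[] means that
    [v x = C + mu ]a, x]] almost everywhere; this makes [Dv] unique on [I] and
    linear in [v], and shows that the traces of [v] are [C] and [C + mu I].
    Since [Omega_x = 0], [Omega] is a constant [c] on [I], and being a selection
    means that [int W(Dv) - c Dv(I)] is minimal at [v = u].  Testing with linear
    functions gives [|c| <= 2], and that the minimum is [(2 - |c|)(b - a)], the
    integral of [min (W(p) - c p) = 2 - |c|].  As [|Du + dx| + |Du - dx| - c Du]
    is bounded below by [(2 - |c|) dx] on every Borel set, equality on [I] forces
    equality on every Borel subset of [I], hence [|Du| <= dx] if [|c| < 2],
    [Du >= dx] if [c = 2] and [Du <= - dx] if [c = - 2].  The boundary conditions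
    then select the possible values of [c].  Conversely, a function satisfying one
    of these three conditions is minimal for [c = 0], [2] or [- 2]. *)

Set Implicit Arguments.
Unset Strict Implicit.
Unset Printing Implicit Defensive.

(** * Test functions and the du Bois-Reymond lemma *)

(** The obstacle is that [measure_deriv] constrains a charge on Borel subsets of [I] alone, and that
    [Dmeas] is an arbitrary choice among the charges it admits. Hence every statement about [Dmeas]
    is restricted to sets [E] included in [I], and its values there are computed by exhibiting any
    charge with the right distribution function. That function is taken over []a, x]], so that it is
    right-continuous and an identity valid almost everywhere becomes pointwise. The integral of
    [W(Dv)] is a sum of two total variations with unrelated Hahn decompositions. It is bounded below
    by splitting [I] into [E] and its complement, which is all that the localization to [E]
    requires. It is evaluated exactly only when [Dv + dx] and [Dv - dx] each have a constant sign on
    [I], which covers the three kinds of steady states. The linear test functions have slopes of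
    modulus at least 1, where [W(p) = 2|p|]: large slopes force [|c| <= 2], and modulus 1 gives the
    minimum. *)

Section fubini.
Context {R : realType}.
Notation mR := (measurableTypeR R).

(** Fubini on the half plane [y <= x]. With [m2] the Lebesgue measure or a Jordan part, densities
    and charges are treated at once; the measurability half is kept because it makes primitives
    measurable. *)
Lemma Rintegral_fubini_le (m1 m2 : {sigma_finite_measure set mR -> \bar R})
    (h k : R -> R) :
  m1.-integrable setT (EFin \o h) -> m2.-integrable setT (EFin \o k) ->
  measurable_fun (setT : set mR)
    (fun x : mR => h x * \int[m2]_(y in `]-oo, x]) k y) /\
  \int[m1]_x (h x * \int[m2]_(y in `]-oo, x]) k y) =
  \int[m2]_y (k y * \int[m1]_(x in `[y, +oo[) h x).
Proof.
move=> ih ik.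
have mh : measurable_fun setT h by case/integrableP: ih => /measurable_EFinP.
have mk : measurable_fun setT k by case/integrableP: ik => /measurable_EFinP.
pose D : set (mR * mR) := [set xy | xy.2 <= xy.1].
have mD : measurable D.
  have mle : measurable_fun setT (fun xy : mR * mR => xy.2 <= xy.1).
    by apply: measurable_fun_ler; [exact: measurable_snd|exact: measurable_fst].
  rewrite -[D]setTI (_ : D = (fun xy : mR * mR => xy.2 <= xy.1) @^-1` [set true]).
    by apply: mle.
  by apply/seteqP; split => xy /=.
pose f (xy : mR * mR) := (h xy.1 * k xy.2 * \1_D xy)%:E.
have mf : measurable_fun setT f.
  apply/measurable_EFinP; apply: measurable_funM; first apply: measurable_funM.
  - exact: (measurableT_comp mh measurable_fst).
  - exact: (measurableT_comp mk measurable_snd).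
  - exact: measurable_indic.
have Fx x : (\int[m2]_y f (x, y) = (h x * \int[m2]_(y in `]-oo, x]) k y)%:E)%E.
  have ikx : m2.-integrable `]-oo, x] (EFin \o k) by exact: integrableS ik.
  rewrite EFinM /Rintegral fineK; last exact: integrable_fin_num.
  rewrite -integralZl// [RHS]integral_mkcond; apply: eq_integral => y _.
  rewrite /f patchE /= indicE.
  have -> : ((x, y) \in D) = (y \in `]-oo, x]%classic).
    by apply/idP/idP; rewrite !inE /D.
  by case: ifPn => _; rewrite ?mulr1 ?mulr0.
have Fy y : (\int[m1]_x f (x, y) = (k y * \int[m1]_(x in `[y, +oo[) h x)%:E)%E.
  have ihy : m1.-integrable `[y, +oo[ (EFin \o h) by exact: integrableS ih.
  rewrite EFinM /Rintegral fineK; last exact: integrable_fin_num.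
  rewrite -integralZl// [RHS]integral_mkcond; apply: eq_integral => x _.
  rewrite /f patchE /= indicE.
  have -> : ((x, y) \in D) = (x \in `[y, +oo[%classic).
    by apply/idP/idP; rewrite !inE /D /= ?in_itv /= ?andbT.
  by case: ifPn => _; rewrite ?mulr1 ?mulr0// mulrC.
have intf : (m1 \x m2)%E.-integrable setT f.
  apply/integrable12ltyP => //.
  pose K := (\int[m2]_y `|(k y)%:E|)%E.
  have K_fin : K \is a fin_num.
    rewrite ge0_fin_numE; last exact: integral_ge0.
    by case/integrableP: ik.
  apply: (@le_lt_trans _ _ (\int[m1]_x (K * `|(h x)%:E|))%E).
    apply: ge0_le_integral => //.
    - by move=> x _; exact: integral_ge0.
    - apply: (measurable_fun_fubini_tonelli_F (abse \o f)) => //=.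
      exact: measurableT_comp.
    - apply: emeasurable_funM => //; apply: measurableT_comp => //.
      exact/measurable_EFinP.
    - move=> x _.
      have -> : (K * `|(h x)%:E| = \int[m2]_y (`|(h x)%:E| * `|(k y)%:E|))%E.
        rewrite muleC ge0_integralZl//.
        by apply: measurableT_comp => //; exact/measurable_EFinP.
      apply: ge0_le_integral => //.
      + apply: measurableT_comp => //.
        exact: (measurableT_comp mf (measurable_pair1 x)).
      + apply: emeasurable_funM => //; apply: measurableT_comp => //.
        exact/measurable_EFinP.
      + move=> y _; rewrite /f /= lee_fin !normrM ler_piMr ?mulr_ge0//.
        by rewrite indicE; case: (_ \in _); rewrite ?normr1 ?normr0.
  rewrite ge0_integralZl//; last exact: integral_ge0.
    rewrite lte_mul_pinfty//; first exact: integral_ge0.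
    by case/integrableP: ih.
  by apply: measurableT_comp => //; exact/measurable_EFinP.
split.
  apply/measurable_EFinP; have := measurable_fubini_F intf.
  by apply: eq_measurable_fun => x _; rewrite /fubini_F Fx.
have := Fubini intf.
under eq_integral do rewrite Fx.
under [RHS]eq_integral do rewrite Fy.
by move=> H; rewrite /Rintegral H.
Qed.

End fubini.

Section test_functions.
Context {R : realType}.
Variables a b : R.
Hypothesis hab : a < b.

Notation mR := (measurableTypeR R).
Notation I := (`]a, b[%classic : set mR).
Notation lambda := (@lebesgue_measure R).

Lemma continuous_bounded_itv (f : R -> R) : continuous f ->
  [bounded f x | x in I].
Proof.
move=> cf.
have cA : {within `[a, b]%classic, continuous f} by exact: continuous_subspaceT.
have /compact_bounded[M [Mr HM]] := continuous_compact cA (@segment_compact _ a b).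
exists M; split => // N MN x /= xI; apply: HM => //=.
by exists x => //=; exact: subset_itv_oo_cc.
Qed.

Lemma test_fun_continuous (phi : R -> R) : test_fun a b phi -> continuous phi.
Proof. by case=> d _ _ x; apply/differentiable_continuous/derivable1_diffP. Qed.

Lemma test_fun_out (phi : R -> R) : test_fun a b phi ->
  phi a = 0 /\ phi b = 0.
Proof.
case=> _ _ [c [d [ac db H]]]; split; apply/eqP; apply: contraT => /H /andP[];
lra.
Qed.

Lemma test_fun_itv_integral (phi : R -> R) y : test_fun a b phi -> y < b ->
  \int[lambda]_(x in `[y, b[) derive1 phi x = - phi y.
Proof.
move=> tphi yb; have [dphi cphi _] := tphi.
have [_ phib] := test_fun_out tphi.
have cc : {within `[y, b]%classic, continuous (derive1 phi)}.
  exact: continuous_subspaceT.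
rewrite Rintegral_itv_bndo_bndc; last first.
  apply: (@integrableS _ mR _ _ (`[y, b]%classic : set mR)) => //.
    exact: subset_itv_co_cc.
  exact: (continuous_compact_integrable (@segment_compact _ y b)).
rewrite /Rintegral (@continuous_FTC2 _ (derive1 phi) phi)//.
  by rewrite phib /= sub0r.
have ct := test_fun_continuous tphi.
split; first by move=> z _; exact: dphi.
  by apply: cvg_at_right_filter; exact: ct.
by apply: cvg_at_left_filter; exact: ct.
Qed.

Lemma lambdaI_lty : (lambda I < +oo)%E.
Proof. by rewrite lebesgue_measure_itv/= lte_fin hab ltry. Qed.

Lemma integrable_continuous_I (f : R -> R) : continuous f ->
  lambda.-integrable I (EFin \o f).
Proof.
move=> cf; apply: measurable_bounded_integrable => //.
- exact: lambdaI_lty.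
- by apply: measurable_funTS; apply: continuous_measurable_fun; exact: cf.
- exact: continuous_bounded_itv.
Qed.

Lemma integrableMc (m : {measure set mR -> \bar R}) (g f : R -> R) :
  m.-integrable I (EFin \o g) -> continuous f ->
  m.-integrable I (EFin \o (fun x => g x * f x)).
Proof.
move=> ig cf.
have -> : EFin \o (fun x => g x * f x) = ((EFin \o g) \* (EFin \o f))%E.
  by apply/funext => x /=; rewrite EFinM.
apply: integrableMl => //.
- by apply: measurable_funTS; apply: continuous_measurable_fun; exact: cf.
- exact: continuous_bounded_itv.
Qed.

Lemma restrict_I_le (g : R -> R) x : I x ->
  (g \_ I) \_ `]-oo, x] = g \_ `]a, x].
Proof.
rewrite /= in_itv /= => /andP[ax xb]; apply/funext => y; rewrite !patchE !mem_setE.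
by rewrite !in_itv/=; have [ay|ya] := ltP a y; have [yx|xy] := leP y x;
  have [yb|byy] := ltP y b => //=; lra.
Qed.

Lemma restrict_I_ge (g : R -> R) y : I y ->
  (g \_ I) \_ `[y, +oo[ = g \_ `[y, b[.
Proof.
rewrite /= in_itv /= => /andP[ay yb]; apply/funext => x; rewrite !patchE !mem_setE.
by rewrite !in_itv/=; have [ax|xa] := ltP a x; have [yx|xy] := leP y x;
  have [xb|bx] := ltP x b => //=; lra.
Qed.

(** This is the measurability half of [Rintegral_fubini_le], with [h] the indicator of [I]. *)
Lemma prim_measurable (m : {sigma_finite_measure set mR -> \bar R}) (g : R -> R) :
  m.-integrable I (EFin \o g) ->
  measurable_fun I (fun x : mR => \int[m]_(y in `]a, x]) g y).
Proof.
move=> ig.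
pose k := g \_ I; pose h : R -> R := (cst 1 : R -> R) \_ I.
have ik : m.-integrable setT (EFin \o k).
  by rewrite /k -restrict_EFin; apply: (iffLR (integrable_mkcond _ _)) => //; exact: measurable_itv.
have ih : lambda.-integrable setT (EFin \o h).
  rewrite /h -restrict_EFin; apply: (iffLR (integrable_mkcond _ _)); first exact: measurable_itv.
  by apply: integrable_continuous_I => x; exact: cvg_cst.
have [+ _] := Rintegral_fubini_le ih ik.
move/(measurable_funS measurableT (@subsetT _ I)).
apply: eq_measurable_fun => x xI.
rewrite /h patchE xI mul1r Rintegral_mkcond [RHS]Rintegral_mkcond.
by rewrite /k restrict_I_le//; exact/set_mem.
Qed.

Lemma prim_bounded (m : {measure set mR -> \bar R}) (g : R -> R) x :
  m.-integrable I (EFin \o g) -> I x ->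
  `|\int[m]_(y in `]a, x]) g y| <= \int[m]_(y in I) `|g y|.
Proof.
move=> ig; rewrite /= in_itv/= => /andP[ax xb].
have sub : `]a, x] `<=` I by apply: subset_itvl; rewrite bnd_simp.
apply: (le_trans (le_normr_Rintegral _ _)) => //; first exact: integrableS ig.
have ig' := integrable_norm ig.
rewrite fine_le//.
- by apply: integrable_fin_num => //; exact: integrableS ig'.
- exact: integrable_fin_num.
apply: ge0_subset_integral => //.
by case/integrableP: ig'.
Qed.

(** Integration by parts by exchanging integrals: mass of [m] at [y] is seen by the inner integral
    for all [x >= y], and the derivative of [phi] integrates to [- phi y] over [[y, b[]. No
    continuity of the primitive is involved, so [m] may have atoms. *)
Lemma prim_weak (m : {sigma_finite_measure set mR -> \bar R}) (g phi : R -> R) :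
  m.-integrable I (EFin \o g) -> test_fun a b phi ->
  \int[lambda]_(x in I) ((\int[m]_(y in `]a, x]) g y) * derive1 phi x) =
  - \int[m]_(y in I) (g y * phi y).
Proof.
move=> ig tphi; have [dphi cphi _] := tphi.
pose k := g \_ I; pose h := (derive1 phi) \_ I.
have ik : m.-integrable setT (EFin \o k).
  by rewrite /k -restrict_EFin; apply: (iffLR (integrable_mkcond _ _)) => //; exact: measurable_itv.
have ih : lambda.-integrable setT (EFin \o h).
  rewrite /h -restrict_EFin; apply: (iffLR (integrable_mkcond _ _)); first exact: measurable_itv.
  exact: integrable_continuous_I.
have [_ fub] := Rintegral_fubini_le ih ik.
rewrite Rintegral_mkcond; transitivity (\int[lambda]_x (h x * \int[m]_(y in `]-oo, x]) k y)).
  apply: eq_Rintegral => x _; rewrite /h !patchE.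
  case: ifPn => xI; last by rewrite mul0r.
  rewrite mulrC; congr (_ * _).
  by rewrite Rintegral_mkcond [RHS]Rintegral_mkcond restrict_I_le//; exact/set_mem.
rewrite fub -mulN1r -RintegralZl//; last exact/integrableMc/test_fun_continuous.
rewrite [RHS]Rintegral_mkcond; apply: eq_Rintegral => y _; rewrite /k !patchE.
case: ifPn => yI; last by rewrite mul0r.
rewrite Rintegral_mkcond restrict_I_ge; last exact/set_mem.
rewrite -Rintegral_mkcond test_fun_itv_integral//; first by rewrite mulrN mulN1r.
by move: yI; rewrite inE /= in_itv => /andP[].
Qed.

End test_functions.

Section almost_everywhere.
Context {R : realType}.
Notation lambda := (@lebesgue_measure R).

Lemma ae_mono (P Q : R -> Prop) : (forall x, P x -> Q x) ->
  (\forall x \ae lambda, P x) -> \forall x \ae lambda, Q x.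
Proof.
move=> PQ; apply: (@filterS _ _ (ae_filter_ringOfSetsType lambda)); exact: PQ.
Qed.

Lemma ae_and (P Q : R -> Prop) : (\forall x \ae lambda, P x) ->
  (\forall x \ae lambda, Q x) -> \forall x \ae lambda, P x /\ Q x.
Proof. exact: (@filterI _ _ (ae_filter_ringOfSetsType lambda)). Qed.

End almost_everywhere.

(** * The du Bois-Reymond lemma for C^1 test functions *)

Section dubois.
Context {R : realType}.
Variables a b : R.
Hypothesis hab : a < b.

Notation mR := (measurableTypeR R).
Notation I := (`]a, b[%classic : set mR).
Notation lambda := (@lebesgue_measure R).

(** The zero mean makes the primitive vanish to the right of [d], as it does to the left of [c]. *)
Lemma primitive_test_fun (psi : R -> R) c d : continuous psi ->
  a < c -> d < b -> (forall x, psi x != 0 -> c <= x <= d) ->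
  \int[lambda]_(x in I) psi x = 0 ->
  exists2 phi, test_fun a b phi & derive1 phi = psi.
Proof.
move=> cpsi ac db supp int0.
have psi0 x : ~ (c <= x <= d) -> psi x = 0.
  by move=> H; apply/eqP; apply: contra_notT H => /supp.
have psiI : psi \_ I = psi.
  apply/funext => x; rewrite patchE; case: ifPn => // /negP xI.
  rewrite psi0// => /andP[cx xd]; apply: xI; rewrite inE /= in_itv /=; lra.
have ipsi : lambda.-integrable setT (EFin \o psi).
  rewrite -psiI -restrict_EFin; apply: (iffLR (integrable_mkcond _ _)); first exact: measurable_itv.
  exact: integrable_continuous_I.
pose phi x := \int[lambda]_(t in `]-oo, x]) psi t.
have dphi x : derivable phi x 1 /\ derive1 phi x = psi x.
  apply: (@continuous_FTC1 _ psi -oo%O x (x + 1)); rewrite ?ltrDl//.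
  - by apply: integrableS ipsi => //; exact: measurable_itv.
  - by rewrite ltNyr.
  - exact: cpsi.
exists phi; last by apply/funext => x; have [] := dphi x.
split; first by move=> x; have [] := dphi x.
  by rewrite (_ : derive1 phi = psi)//; apply/funext => x; have [] := dphi x.
exists c, d; split => // x; apply: contra_neqT => /negP xcd.
have [xc|cx] := ltP x c.
  rewrite /phi Rintegral_mkcond -[RHS](Rintegral_set0 lambda psi).
  rewrite [RHS]Rintegral_mkcond; apply: eq_Rintegral => t _.
  rewrite !patchE in_set0; case: ifPn => //; rewrite inE /= in_itv /= => tx.
  by apply: psi0; lra.
rewrite -[RHS]int0 /phi Rintegral_mkcond [RHS]Rintegral_mkcond psiI.
apply: eq_Rintegral => t _; rewrite patchE; case: ifPn => //.
rewrite notin_setE /= in_itv/= => /negP; rewrite -ltNge => xt.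
by rewrite psi0// => /andP[ct td]; apply: xcd; lra.
Qed.

(** A continuous approximation from below of the indicator of []c, d[], with ramps of slope [n].
    Indicators themselves are excluded because the derivative of a test function has to be
    continuous. *)
Definition trapezoid (c d : R) (n : nat) (x : R) : R :=
  Num.min 1 (Num.max 0 (n%:R * Num.min (x - c) (d - x))).

Lemma continuous_trapezoid c d n : continuous (trapezoid c d n).
Proof.
move=> x; apply: (@continuous_min _ _ (cst 1)
  (fun y => Num.max 0 (n%:R * Num.min (y - c) (d - y)))); first exact: cvg_cst.
apply: (@continuous_max _ _ (cst 0)
  (fun y => n%:R * Num.min (y - c) (d - y))); first exact: cvg_cst.
apply: cvgM; first exact: cvg_cst.
by apply: (@continuous_min _ _ (fun y => y - c) (fun y => d - y)); apply: cvgB;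
  (exact: cvg_cst || exact: cvg_id).
Qed.

Lemma trapezoid_ge0 c d n x : 0 <= trapezoid c d n x.
Proof. by rewrite le_min ler01 le_max lexx. Qed.

Lemma trapezoid_le1 c d n x : trapezoid c d n x <= 1.
Proof. by rewrite ge_min lexx. Qed.

Lemma trapezoid_out c d n x : trapezoid c d n x != 0 -> c < x < d.
Proof.
apply: contra_neqT => H; rewrite /trapezoid.
have -> : Num.max 0 (n%:R * Num.min (x - c) (d - x)) = 0; last by rewrite min_r.
apply/max_idPl; rewrite mulr_ge0_le0// ge_min.
by move: H; rewrite negb_and -!leNgt => /orP[H|H]; apply/orP; [left|right]; lra.
Qed.

Lemma trapezoid_cvg c d x : c < x < d -> trapezoid c d n x @[n --> \oo] --> (1 : R).
Proof.
move=> /andP[cx xd].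
have m0 : 0 < Num.min (x - c) (d - x) by rewrite lt_min; apply/andP; lra.
apply: cvg_near_cst; near=> n; apply/min_idPl; rewrite le_max; apply/orP; right.
rewrite -ler_pdivrMr// div1r ltW//.
by near: n; exact: nbhs_infty_gtr.
Unshelve. all: end_near. Qed.

Lemma trapezoid_integral_cvg (f : R -> R) c d : L1 a b f -> a < c -> d < b ->
  \int[lambda]_(x in I) (f x * trapezoid c d n x) @[n --> \oo] -->
  \int[lambda]_(x in `]c, d[) f x.
Proof.
move=> Lf ac db.
have mf : measurable_fun I f by case/integrableP: Lf => /measurable_EFinP.
have sub : `]c, d[ `<=` I by move=> x; rewrite /= !in_itv/=; lra.
have := @dominated_convergence _ mR R lambda I (measurable_itv _)
  (fun n x => (f x * trapezoid c d n x)%:E) (fun x => (f \_ `]c, d[ x)%:E) (fun x => `|f x|%:E).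
case.
- move=> n; apply/measurable_EFinP; apply: measurable_funM => //.
  by apply: measurable_funTS; apply: continuous_measurable_fun; exact: continuous_trapezoid.
- apply/measurable_EFinP; apply/measurable_restrict => //.
  by apply: measurable_funS mf.
- apply: aeW => x xI; apply: cvg_EFin; first exact: nearW.
  rewrite patchE; case: ifPn => xcd.
    rewrite -[X in _ --> X]mulr1; apply: cvgM; first exact: cvg_cst.
    by apply: trapezoid_cvg; move: xcd; rewrite inE /= in_itv.
  apply: cvg_near_cst; apply: nearW => n /=.
  have -> : trapezoid c d n x = 0; last by rewrite mulr0.
  apply/eqP; apply: contraNT xcd => /trapezoid_out.
  by rewrite inE /= in_itv.
- exact: integrable_norm.
- apply: aeW => x n xI; rewrite lee_fin normrM ler_piMr//.
  by rewrite ger0_norm ?trapezoid_ge0// trapezoid_le1.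
move=> _ _ H.
have e1 : (\int[lambda]_(x in I) (f \_ `]c, d[ x)%:E = \int[lambda]_(x in `]c, d[) (f x)%:E)%E.
  have -> : (fun x => (f \_ `]c, d[ x)%:E) = (EFin \o f) \_ `]c, d[ by rewrite restrict_EFin.
  by rewrite -integral_mkcondr setIidr.
rewrite /Rintegral; apply: fine_cvg; move: H; rewrite e1 fineK//.
by apply: integrable_fin_num => //; exact: integrableS Lf.
Qed.


Lemma Rintegral_cst_itv (r c d : R) : c < d ->
  \int[lambda]_(x in `]c, d[) (cst r x) = r * (d - c).
Proof.
move=> cd; rewrite Rintegral_cst; last exact: measurable_itv.
congr (_ * _); have := @lebesgue_measure_itv R `]c, d[; rewrite /= lte_fin cd => E.
by transitivity (fine (lambda `]c, d[%classic)) => //; rewrite E.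
Qed.

(** Every compactly supported continuous function of mean zero is the derivative of a test function,
    so the integral of [h] against a trapezoid is [C] times the integral of the trapezoid, for one
    constant [C]. Letting the trapezoids tend to indicators, [h] has mean [C] on every interval well
    inside [I], and Lebesgue differentiation concludes. *)
Lemma dubois_reymond (h : R -> R) : L1 a b h ->
  (forall phi, test_fun a b phi -> \int[lambda]_(x in I) (h x * derive1 phi x) = 0) ->
  exists C, \forall x \ae lambda, I x -> h x = C.
Proof.
move=> Lh H.
have L11 : L1 a b (cst 1) by apply: integrable_continuous_I => // x; exact: cvg_cst.
(* The middle third of [I] carries the reference trapezoid that normalizes [C]. *)
pose c0 := a + (b - a) / 3; pose d0 := a + (b - a) * 2 / 3.
have [ac0 [cd0 db0]] : a < c0 /\ c0 < d0 /\ d0 < b.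
  by have := hab; rewrite /c0 /d0; split; [|split]; lra.
pose J (f : R -> R) c d n := \int[lambda]_(x in I) (f x * trapezoid c d n x).
have [n0 J0] : exists n, J (cst 1) c0 d0 n != 0.
  have Jlim : J (cst 1) c0 d0 n @[n --> \oo] --> d0 - c0.
    have := trapezoid_integral_cvg L11 ac0 db0.
    by rewrite (Rintegral_cst_itv 1 cd0) mul1r.
  have : \forall n \near \oo, 0 < J (cst 1) c0 d0 n.
    by apply: (cvgr_gt (d0 - c0)) => //; rewrite subr_gt0.
  by case=> n _ /(_ n (leqnn n)) /lt0r_neq0 ?; exists n.
pose C := J h c0 d0 n0 / J (cst 1) c0 d0 n0.
have itrap f c d n : L1 a b f -> lambda.-integrable I (EFin \o (fun x => f x * trapezoid c d n x)).
  by move=> Lf; apply: integrableMc => //; exact: continuous_trapezoid.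
have JC c d n : a < c -> d < b -> J h c d n = C * J (cst 1) c d n.
  move=> ac db.
  (* [psi] has mean zero, so it is the derivative of a test function. *)
  pose k := J (cst 1) c d n / J (cst 1) c0 d0 n0.
  pose psi x := trapezoid c d n x - k * trapezoid c0 d0 n0 x.
  have cpsi : continuous psi.
    move=> x; apply: cvgB; first exact: continuous_trapezoid.
    by apply: cvgM; [exact: cvg_cst|exact: continuous_trapezoid].
  have spsi x : psi x != 0 -> Num.min c c0 <= x <= Num.max d d0.
    rewrite ge_min le_max; apply: contra_neqT; rewrite negb_and !negb_or -!ltNge => Hx.
    have -> : psi x = 0 - k * 0; last by rewrite mulr0 subr0.
    rewrite /psi; congr (_ - _ * _); apply/eqP; apply: contraTT Hx => /trapezoid_out; lra.
  have split_int f : L1 a b f ->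
      \int[lambda]_(x in I) (f x * psi x) = J f c d n - k * J f c0 d0 n0.
    move=> Lf; rewrite /J -RintegralZl//; last exact: itrap.
    rewrite -RintegralB//; last 2 first.
    - exact: itrap.
    - exact: (@integrableZl _ _ _ lambda I _ k _ (itrap f c0 d0 n0 Lf)).
    by apply: eq_Rintegral => x _; rewrite /psi mulrBr; congr (_ - _); rewrite mulrCA.
  have [|||phi tphi dphi] := primitive_test_fun cpsi _ _ spsi.
  - by rewrite lt_min ac ac0.
  - by rewrite gt_max db db0.
  - transitivity (\int[lambda]_(x in I) (cst 1 x * psi x)).
      by apply: eq_Rintegral => x _; rewrite mul1r.
    by rewrite split_int// /k divfK// subrr.
  have := H _ tphi; rewrite dphi split_int// /C /k => /eqP; rewrite subr_eq0 => /eqP ->.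
  by rewrite [LHS]mulrC mulrA mulrAC.
have intC c d : a < c -> c < d -> d < b -> \int[lambda]_(x in `]c, d[) h x = C * (d - c).
  move=> ac cd db.
  apply: (@cvg_unique _ _ (J h c d n @[n --> \oo])) => //; first exact: trapezoid_integral_cvg.
  rewrite (_ : J h c d = fun n => C * J (cst 1) c d n); last by apply/funext => n; exact: JC.
  apply: cvgM; first exact: cvg_cst.
  have := trapezoid_integral_cvg L11 ac db.
  by rewrite (Rintegral_cst_itv 1 cd) mul1r.
exists C.
pose f := h \_ I.
have iF : lambda.-integrable setT (EFin \o f).
  by rewrite /f -restrict_EFin; apply: (iffLR (integrable_mkcond _ _)) => //; exact: measurable_itv.
(* Almost everywhere the primitive of [f] is differentiable with derivative [f x]; it remains to see
   that it is affine of slope [C] near [x]. *)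
have := @FTC1Ny _ f _ _.
have /[swap] /[apply] : locally_integrable [set: R] f by exact: integrable_locally_restrict.
have /[swap] /[apply] : forall y, lambda.-integrable `]-oo, y] (EFin \o f).
  by move=> y; apply: integrableS iF => //; exact: measurable_itv.
apply: ae_mono.
move=> x [_ Fx]; rewrite /= in_itv/= => /andP[ax xb].
have <- : f x = h x by rewrite /f patchE ifT// inE /= in_itv/= ax.
rewrite -Fx.
(* The base point lies strictly between [a] and [x], since [intC] asks for intervals away from the
   ends of [I]. *)
pose x0 := (a + x) / 2.
pose F y := \int[lambda]_(t in `]-oo, y]) f t.
have FE y : x0 < y < b -> F y = F x0 + C * (y - x0).
  move=> /andP[xy yb].
  rewrite -[LHS](subrK (F x0)) addrC; congr (_ + _).
  have iy : lambda.-integrable `]-oo, y] (EFin \o f).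
    by apply: integrableS iF => //; exact: measurable_itv.
  rewrite /F (Rintegral_itvB iy) ?bnd_simp ?ltNyr//; last exact: ltW.
  rewrite -(intC x0 y)//; last by rewrite /x0; lra.
  have sub : `]x0, y[ `<=` I by move=> t; rewrite /= !in_itv/= /x0; lra.
  rewrite Rintegral_itv_bndo_bndc; last by apply: integrableS Lh.
  rewrite [RHS]Rintegral_mkcond [LHS]Rintegral_mkcond; apply: eq_Rintegral => t _.
  rewrite !patchE; case: ifPn => // ty; rewrite /f patchE ifT//.
  by move: ty; rewrite !inE /= !in_itv/= /x0; lra.
rewrite derive1E -/F.
rewrite (@near_eq_derive _ _ _ _ (fun y => F x0 + C * (y - x0))); last first.
  have xI : x \in `]x0, b[ by rewrite in_itv/= xb andbT /x0; lra.
  by near=> y; apply: FE; near: y; have := near_in_itvoo xI.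
have /@derive_val -> // : is_derive x 1 (fun y : R => F x0 + C * (y - x0)) C.
by apply: is_derive_eq; rewrite add0r mul1r subr0; exact: mulr1.
Unshelve. all: end_near. Qed.

End dubois.

(** * Charges and their distribution functions *)

Section charges.
Context {R : realType}.
Notation mR := (measurableTypeR R).
Notation rcharge := (charge mR R).

Definition reval (mu : rcharge) (E : set mR) : R := fine (mu E).

Lemma revalE (mu : rcharge) E : measurable E -> mu E = (reval mu E)%:E.
Proof. by move=> mE; rewrite /reval fineK//; exact: fin_num_measure. Qed.

Lemma reval0 (mu : rcharge) : reval mu set0 = 0.
Proof. by rewrite /reval charge0. Qed.

Lemma revalU (mu : rcharge) A B : measurable A -> measurable B ->
  A `&` B = set0 -> reval mu (A `|` B) = reval mu A + reval mu B.
Proof.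
move=> mA mB AB; rewrite /reval chargeU// fineD//; exact: fin_num_measure.
Qed.

Lemma revalD (mu nu : rcharge) E : measurable E ->
  reval (cadd mu nu) E = reval mu E + reval nu E.
Proof. by move=> mE; rewrite /reval/= /cadd/= fineD//; exact: fin_num_measure. Qed.

Lemma revalN (mu : rcharge) E : reval (copp mu) E = - reval mu E.
Proof. by rewrite /reval/= /copp/= fineN. Qed.

Lemma revalZ (mu : rcharge) (r : R) E : measurable E ->
  reval (cscale r mu) E = r * reval mu E.
Proof. by move=> mE; rewrite /reval/= /cscale/= fineM//; exact: fin_num_measure. Qed.

Lemma reval_setD (mu : rcharge) A B : measurable A -> measurable B -> A `<=` B ->
  reval mu (B `\` A) = reval mu B - reval mu A.
Proof.
move=> mA mB AB; have mBA : measurable (B `\` A) by exact: measurableD.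
rewrite -[X in _ = reval mu X - _](setDUK AB) revalU ?setDIK//.
by rewrite addrC addKr.
Qed.

(** Dominated convergence for indicators, the constant 1 being integrable for a finite measure. No
    monotonicity in [n] is asked, because the sequential criteria for one-sided limits produce
    arbitrary sequences. *)
Lemma cvg_finite_measure (m : {finite_measure set mR -> \bar R}) (A_ : nat -> set mR) A :
  (forall n, measurable (A_ n)) -> measurable A ->
  (forall x, \forall n \near \oo, A_ n x <-> A x) ->
  fine (m (A_ n)) @[n --> \oo] --> fine (m A).
Proof.
move=> mA_ mA H.
have := @dominated_convergence _ mR R m setT measurableT
  (fun n x => (\1_(A_ n) x)%:E) (fun x => (\1_A x)%:E) (cst 1%E).
case.
- by move=> n; apply/measurable_EFinP; exact: measurable_indic.
- by apply/measurable_EFinP; exact: measurable_indic.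
- apply: aeW => x _; apply: cvg_EFin; first exact: nearW.
  apply: cvg_near_cst; have := H x; apply: filterS => n Hn.
  rewrite !indicE; congr (_%:R); congr nat_of_bool.
  by apply/idP/idP; rewrite !inE => /Hn.
- exact: (@finite_measure_integrable_cst _ _ _ m setT 1 measurableT).
- by apply: aeW => x n _; rewrite indicE lee_fin ger0_norm//; case: (_ \in _).
move=> _ _; rewrite integral_indic// setIT => Hc.
apply: fine_cvg; rewrite fineK ?fin_num_measure//.
by move: Hc; under eq_fun do rewrite integral_indic// setIT.
Qed.

Lemma cvg_charge (mu : rcharge) (A_ : nat -> set mR) A :
  (forall n, measurable (A_ n)) -> measurable A ->
  (forall x, \forall n \near \oo, A_ n x <-> A x) ->
  reval mu (A_ n) @[n --> \oo] --> reval mu A.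
Proof.
move=> mA_ mA H.
pose jp := jordan_pos (hahn_posneg mu); pose jn := jordan_neg (hahn_posneg mu).
have jE E : measurable E -> reval mu E = fine (jp E) - fine (jn E).
  move=> mE; rewrite /reval (jordan_decomp (hahn_posneg mu) mE)/= /cadd/= cscaleN1.
  by rewrite fineB//; exact: fin_num_measure.
rewrite jE//.
rewrite (_ : (fun n => reval mu (A_ n)) = (fun n => fine (jp (A_ n)) - fine (jn (A_ n)))).
  by apply: cvgB; exact: cvg_finite_measure.
by apply/funext => n; rewrite jE.
Qed.

End charges.

Section cdf.
Context {R : realType}.
Variables a b : R.
Hypothesis hab : a < b.
Notation mR := (measurableTypeR R).
Notation I := (`]a, b[%classic : set mR).
Notation lambda := (@lebesgue_measure R).
Notation rcharge := (charge mR R).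

Definition cdf (mu : rcharge) (x : R) : R := reval mu `]a, x].

Lemma cdf_cvg_right (mu : rcharge) x0 : a <= x0 ->
  cdf mu x @[x --> x0^'+] --> cdf mu x0.
Proof.
move=> ax0; apply/cvg_at_rightP => u [ux0 uc].
apply: cvg_charge => //.
move=> x; rewrite /= in_itv/=.
have [xx0|x0x] := leP x x0.
  apply: nearW => n; by rewrite !in_itv/= (le_trans xx0)// ltW.
near=> n; rewrite !in_itv/=.
have ux : u n < x by near: n; exact: (cvgr_lt x0).
by rewrite (leNgt x) ux.
Unshelve. all: end_near. Qed.

(** The limit is the mass of the open interval: []a, x]] never contains [b] for [x < b], so a mass
    of [mu] at [b] is not seen. *)
Lemma cdf_cvg_left (mu : rcharge) : cdf mu x @[x --> b^'-] --> reval mu I.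
Proof.
apply/cvg_at_leftP => u [ub uc].
apply: cvg_charge => //.
move=> x; rewrite /= in_itv/=.
have [bx|xb] := leP b x.
  by apply: nearW => n; rewrite !in_itv/= (leNgt x) (lt_le_trans (ub n))// !andbF.
near=> n; rewrite !in_itv/=.
have -> // : x <= u n.
by apply: ltW; near: n; exact: (cvgr_gt b).
Unshelve. all: end_near. Qed.

Lemma cdfa (mu : rcharge) : cdf mu a = 0.
Proof. by rewrite /cdf set_itvoc0 ?reval0. Qed.

(** A null set contains no nonempty open interval. This turns properties valid almost everywhere
    into actual points arbitrarily close to an endpoint. *)
Lemma ae_itv (P : R -> Prop) c d : a <= c -> c < d -> d <= b ->
  (\forall x \ae lambda, I x -> P x) -> exists2 x, c < x < d & P x.
Proof.
move=> ac cd db [N [mN N0 sub]]; apply: contrapT => H.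
have : (lambda `]c, d[ <= lambda N)%E.
  apply: le_measure; rewrite ?inE//.
  move=> x xcd; apply: sub => /= Px; apply: H; exists x.
    by move: xcd; rewrite /= in_itv.
  by apply: Px; move: xcd; rewrite /= !in_itv/=; lra.
by rewrite N0 lebesgue_measure_itv/= lte_fin cd -EFinB lee_fin subr_le0 leNgt cd.
Qed.

Lemma ae_near_right (P Q : R -> Prop) c : a <= c -> c < b ->
  (\forall x \ae lambda, I x -> P x) -> (\forall x \near c^'+, Q x) ->
  exists x, [/\ I x, P x & Q x].
Proof.
move=> ac cb aeP [e /= e0 He].
have [|||x /andP[cx xd] [Ix Px]] := @ae_itv (fun x => I x /\ P x) c (Num.min b (c + e)) ac.
- by rewrite lt_min cb ltrDl.
- by rewrite ge_min lexx.
- by apply: ae_mono aeP => x H Ix; split => //; exact: H.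
exists x; split => //; apply: He => //=.
by rewrite ltr0_norm; move: xd; rewrite lt_min => /andP[]; lra.
Qed.

Lemma ae_near_left (P Q : R -> Prop) c : a < c -> c <= b ->
  (\forall x \ae lambda, I x -> P x) -> (\forall x \near c^'-, Q x) ->
  exists x, [/\ I x, P x & Q x].
Proof.
move=> ac cb aeP [e /= e0 He].
have [||||x /andP[cx xd] [Ix Px]] := @ae_itv (fun x => I x /\ P x) (Num.max a (c - e)) c.
- by rewrite le_max lexx.
- by rewrite gt_max ac; lra.
- by [].
- by apply: ae_mono aeP => x H Ix; split => //; exact: H.
exists x; split => //; apply: He => //=.
by rewrite gtr0_norm; move: cx; rewrite gt_max => /andP[]; lra.
Qed.

Lemma ae_lim_right (f g : R -> R) (c l1 l2 : R) : a <= c -> c < b ->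
  (\forall x \ae lambda, I x -> f x = g x) ->
  f x @[x --> c^'+] --> l1 -> g x @[x --> c^'+] --> l2 -> l1 = l2.
Proof.
move=> ac cb fg fl gl; apply/eqP; rewrite -subr_eq0; apply: contrapT => /negP l12.
have fgl : (fun x => f x - g x) @ c^'+ --> (l1 - l2 : R) by exact: cvgB.
have [x [_ fgx /negP]] := ae_near_right ac cb fg (cvgr_neq0 _ fgl l12).
by rewrite fgx subrr eqxx.
Qed.

Lemma ae_lim_left (f g : R -> R) (c l1 l2 : R) : a < c -> c <= b ->
  (\forall x \ae lambda, I x -> f x = g x) ->
  f x @[x --> c^'-] --> l1 -> g x @[x --> c^'-] --> l2 -> l1 = l2.
Proof.
move=> ac cb fg fl gl; apply/eqP; rewrite -subr_eq0; apply: contrapT => /negP l12.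
have fgl : (fun x => f x - g x) @ c^'- --> (l1 - l2 : R) by exact: cvgB.
have [x [_ fgx /negP]] := ae_near_left ac cb fg (cvgr_neq0 _ fgl l12).
by rewrite fgx subrr eqxx.
Qed.

Definition has_cdf (u : R -> R) (C : R) (mu : rcharge) :=
  \forall x \ae lambda, I x -> u x = C + cdf mu x.

Lemma trace_unique_a (u f : R -> R) (k l : R) :
  (\forall x \ae lambda, I x -> u x = f x) -> f x @[x --> a^'+] --> k ->
  trace a b u a^'+ l -> l = k.
Proof.
move=> uf fk [w uw wl]; apply: (ae_lim_right (lexx a) hab _ wl fk).
by apply: ae_mono (ae_and uf uw) => x [H1 H2] xI; rewrite -H1// -H2.
Qed.

Lemma trace_unique_b (u f : R -> R) (k l : R) :
  (\forall x \ae lambda, I x -> u x = f x) -> f x @[x --> b^'-] --> k ->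
  trace a b u b^'- l -> l = k.
Proof.
move=> uf fk [w uw wl]; apply: (ae_lim_left hab (lexx b) _ wl fk).
by apply: ae_mono (ae_and uf uw) => x [H1 H2] xI; rewrite -H1// -H2.
Qed.

Lemma has_cdf_trace_a u C mu l : has_cdf u C mu -> trace a b u a^'+ l -> l = C.
Proof.
move=> H; apply: (trace_unique_a H).
rewrite -[X in _ --> X]addr0 -(cdfa mu).
by apply: cvgD; [exact: cvg_cst|exact: cdf_cvg_right].
Qed.

Lemma has_cdf_trace_b u C mu l : has_cdf u C mu -> trace a b u b^'- l ->
  l = C + reval mu I.
Proof.
move=> H; apply: (trace_unique_b H).
by apply: cvgD; [exact: cvg_cst|exact: cdf_cvg_left].
Qed.

(** A Dynkin argument: the open rays are stable under intersection and generate the Borel sets, and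
    the sets [E] with [nu (E & I) = 0] form a Dynkin system. Intersecting with [I] is essential, as
    [nu] is arbitrary outside. *)
Lemma reval_eq0 (nu : rcharge) : (forall x, I x -> cdf nu x = 0) ->
  forall E, measurable E -> E `<=` I -> reval nu E = 0.
Proof.
move=> H.
have nuI : reval nu I = 0.
  have c0 : cdf nu x @[x --> b^'-] --> (0 : R).
    apply: cvg_near_cst; near=> x; apply: H; rewrite /= in_itv/=; apply/andP; split; near: x.
      exact: nbhs_left_gt.
    exact: nbhs_left_lt.
  exact: (cvg_unique _ (cdf_cvg_left (mu := nu)) c0).
suff K E : measurable E -> reval nu (E `&` I) = 0.
  by move=> E mE EI; rewrite -(setIidl EI) K.
move=> mE.
have := @dynkin_induction _ mR (@measurable_realfun.RGenOInfty.G R) 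
  (fun E => reval nu (E `&` I) = 0) (@measurable_realfun.RGenOInfty.measurableE R).
move=> /(_ _ _ _ _ _ E); apply.
- move=> _ _ [x ->] [y ->]; exists (Num.max x y).
  by apply/seteqP; split => z; rewrite /= !in_itv/= !andbT gt_max => /andP.
- by rewrite setTI.
- move=> _ [x ->].
  (* The ray []x, +oo[] misses [I], contains [I], or cuts out of it the complement of []a, x]]. *)
  have [bx|xb] := leP b x.
    rewrite (_ : _ `&` _ = set0) ?reval0// -subset0 => z; rewrite /= !in_itv/=; lra.
  have [xa|ax] := leP x a.
    rewrite (_ : _ `&` _ = I)//.
    by apply/seteqP; split => z; rewrite /= !in_itv/=; [case|]; lra.
  rewrite (_ : _ `&` _ = I `\` `]a, x]).
    rewrite reval_setD//; first by rewrite nuI -/(cdf nu x) H ?subrr//= in_itv/= ax.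
    by apply: subset_itvl; rewrite bnd_simp.
  apply/seteqP; split => z; rewrite /= !in_itv/=; first by lra.
  by move=> [/andP[az zb] /negP]; rewrite az/= -ltNge => xz; split; lra.
- move=> S mS S0.
  rewrite (_ : _ `&` _ = I `\` (S `&` I)); last first.
    by rewrite setDIr setDv setU0 setIC setDE.
  rewrite reval_setD//; first by rewrite nuI S0 subrr.
  by apply: measurableI => //; exact: measurable_itv.
- move=> F mF tF F0; rewrite setI_bigcupl.
  have mFI n : measurable (F n `&` I) by apply: measurableI => //; exact: measurable_itv.
  have tFI : trivIset setT (fun n => F n `&` I) by exact: trivIset_setIr.
  have := @charge_semi_sigma_additive _ _ _ nu _ mFI tFI (bigcup_measurable (fun n _ => mFI n)).
  under eq_fun do under eq_bigr do rewrite revalE// F0.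
  under eq_fun do rewrite big1//.
  move=> Hc; have := cvg_unique _ Hc (cvg_cst 0%E).
  by rewrite /reval => ->.
- exact: (eq_ind _ id mE _ (congr1 (fun M => M E) (@measurable_realfun.RGenOInfty.measurableE R))).
Unshelve. all: end_near. Qed.

End cdf.

(** * Weak and measure derivatives characterized by primitives *)

Section derivatives.
Context {R : realType}.
Variables a b : R.
Hypothesis hab : a < b.
Notation mR := (measurableTypeR R).
Notation I := (`]a, b[%classic : set mR).
Notation lambda := (@lebesgue_measure R).
Notation rcharge := (charge mR R).
Notation cdf := (cdf a).
Notation has_cdf := (has_cdf a b).
Notation L1 := (L1 a b).

Definition primitive (m : {measure set mR -> \bar R}) (g : R -> R) (x : R) : R :=
  \int[m]_(y in `]a, x]) g y.

Lemma L1_measurable u : L1 u -> measurable_fun I u.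
Proof. by case/integrableP => /measurable_EFinP. Qed.

Lemma L1_ext u v : L1 u -> measurable_fun I v ->
  (\forall x \ae lambda, I x -> u x = v x) -> L1 v.
Proof.
move=> Lu mv uv; have mu := L1_measurable Lu.
apply/integrableP; split; first exact/measurable_EFinP.
case/integrableP: (Lu) => _; apply: le_lt_trans.
rewrite le_eqVlt; apply/orP; left; apply/eqP.
apply: ae_eq_integral => //.
- by apply: measurableT_comp => //; exact/measurable_EFinP.
- by apply: measurableT_comp => //; exact/measurable_EFinP.
- by apply: ae_mono uv => x H Ix /=; rewrite H.
Qed.

Lemma L1_continuous f : continuous f -> L1 f.
Proof. exact: integrable_continuous_I. Qed.

Lemma L1_cst (k : R) : L1 (fun=> k).
Proof. by apply: L1_continuous => x; exact: cvg_cst. Qed.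

Lemma L1D u v : L1 u -> L1 v -> L1 (fun x => u x + v x).
Proof. by move=> Lu Lv; apply: (@integrableD _ _ _ lambda I _ _ _ Lu Lv). Qed.

Lemma L1B u v : L1 u -> L1 v -> L1 (fun x => u x - v x).
Proof. by move=> Lu Lv; apply: (@integrableB _ _ _ lambda I _ _ _ Lu Lv). Qed.

Lemma L1_primitive (m : {sigma_finite_measure set mR -> \bar R}) (g : R -> R) :
  m.-integrable I (EFin \o g) -> L1 (primitive m g).
Proof.
move=> ig; apply: measurable_bounded_integrable => //.
- exact: lambdaI_lty.
- exact: prim_measurable.
- exists (\int[m]_(y in I) `|g y|); split; first exact: num_real.
  move=> M HM x /= xI; apply: le_trans (ltW HM).
  exact: (prim_bounded ig xI).
Qed.

Lemma integrable_cst1 (m : {finite_measure set mR -> \bar R}) :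
  m.-integrable I (EFin \o cst 1).
Proof. exact: finite_measure_integrable_cst. Qed.

(** Seeing a mass as the integral of 1 makes the results on primitives with respect to measures
    available for charges. *)
Lemma cdf_jordan (mu : rcharge) x :
  cdf mu x = primitive (jordan_pos (hahn_posneg mu)) (cst 1) x -
             primitive (jordan_neg (hahn_posneg mu)) (cst 1) x.
Proof.
have p1 (m : {finite_measure set mR -> \bar R}) :
    primitive m (cst 1) x = fine (m `]a, x]%classic).
  by rewrite /primitive Rintegral_cst ?mul1r.
rewrite !p1 /cdf /reval (jordan_decomp (hahn_posneg mu))//= /cadd/= cscaleN1.
by rewrite fineB//; exact: fin_num_measure.
Qed.

Lemma L1_cdf (mu : rcharge) : L1 (cdf mu).
Proof.
rewrite (funext (cdf_jordan mu)).
by apply: L1B; exact: (L1_primitive (integrable_cst1 _)).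
Qed.

Lemma integral_EFin u phi : L1 u -> test_fun a b phi ->
  (\int[lambda]_(x in I) (u x * derive1 phi x)%:E =
   (\int[lambda]_(x in I) (u x * derive1 phi x))%:E)%E.
Proof.
move=> Lu [_ cphi _]; rewrite /Rintegral fineK//.
by apply: integrable_fin_num => //; exact: integrableMc.
Qed.

(** One direction is [dubois_reymond]; conversely a constant integrates to zero against the
    derivative of [phi], since [phi] vanishes at both ends. *)
Lemma weak_zeroP h : L1 h ->
  (forall phi, test_fun a b phi ->
     \int[lambda]_(x in I) (h x * derive1 phi x) = 0) <->
  exists C, \forall x \ae lambda, I x -> h x = C.
Proof.
move=> Lh; split; first exact: dubois_reymond.
case=> C hC phi tphi; have [_ cphi _] := tphi.
transitivity (\int[lambda]_(x in I) (C * derive1 phi x)).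
  rewrite /Rintegral; congr fine; apply: ae_eq_integral => //.
  - apply/measurable_EFinP; apply: measurable_funM; first exact: L1_measurable.
    by apply: measurable_funTS; apply: continuous_measurable_fun; exact: cphi.
  - apply/measurable_EFinP; apply: measurable_funM => //.
    by apply: measurable_funTS; apply: continuous_measurable_fun; exact: cphi.
  - by apply: ae_mono hC => x H Ix /=; rewrite H.
rewrite RintegralZl//; last exact: L1_continuous.
rewrite Rintegral_itv_obnd_cbnd; last exact: L1_continuous.
rewrite (test_fun_itv_integral tphi)//.
by have [-> _] := test_fun_out tphi; rewrite oppr0 mulr0.
Qed.

Lemma RintegralMB u v phi : L1 u -> L1 v -> test_fun a b phi ->
  \int[lambda]_(x in I) ((u x - v x) * derive1 phi x) =
  \int[lambda]_(x in I) (u x * derive1 phi x) -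
  \int[lambda]_(x in I) (v x * derive1 phi x).
Proof.
move=> Lu Lv [_ cphi _].
rewrite -RintegralB//; [|exact: integrableMc..].
by apply: eq_Rintegral => x _; rewrite mulrBl.
Qed.

Lemma ae_sub_cst (u F : R -> R) :
  (exists C, \forall x \ae lambda, I x -> u x - F x = C) <->
  (exists C, \forall x \ae lambda, I x -> u x = C + F x).
Proof.
split=> -[C H]; exists C; apply: ae_mono H => x H Ix.
  by rewrite -(H Ix) subrK.
by rewrite (H Ix) addrK.
Qed.

(** By [prim_weak], [g] is a weak derivative exactly when [u] minus the primitive of [g] integrates
    to zero against the derivatives of all test functions. *)
Lemma weak_derivP u g : L1 u -> L1 g -> weak_deriv a b u g <->
  exists C, \forall x \ae lambda, I x -> u x = C + primitive lambda g x.
Proof.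
move=> Lu Lg; have Lp := L1_primitive Lg.
apply: iff_trans (ae_sub_cst _ _); apply: iff_trans (weak_zeroP (L1B Lu Lp)).
have eqi phi : test_fun a b phi ->
    (\int[lambda]_(x in I) (g x * phi x)%:E = (\int[lambda]_(x in I) (g x * phi x))%:E)%E.
  move=> tphi; rewrite /Rintegral fineK//.
  by apply: integrable_fin_num => //; apply: integrableMc => //; exact: test_fun_continuous tphi.
split=> H phi tphi; have := H _ tphi;
  rewrite RintegralMB// /primitive prim_weak// opprK ?integral_EFin// ?eqi//.
- by rewrite -EFinN => -[->]; rewrite addNr.
- by move=> /eqP; rewrite addr_eq0 => /eqP ->; rewrite EFinN.
Qed.

Lemma measure_derivP u (mu : rcharge) : L1 u -> measure_deriv a b u mu <->
  exists C, has_cdf u C mu.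
Proof.
move=> Lu.
pose jp := jordan_pos (hahn_posneg mu); pose jn := jordan_neg (hahn_posneg mu).
have Lp := L1_primitive (integrable_cst1 jp).
have Ln := L1_primitive (integrable_cst1 jn).
have Lc := L1_cdf mu.
apply: iff_trans (ae_sub_cst _ _); apply: iff_trans (weak_zeroP (L1B Lu Lc)).
have key phi : test_fun a b phi ->
    \int[lambda]_(x in I) ((u x - cdf mu x) * derive1 phi x) =
    \int[lambda]_(x in I) (u x * derive1 phi x) +
    (\int[jp]_(x in I) phi x - \int[jn]_(x in I) phi x).
  move=> tphi; rewrite RintegralMB// (funext (cdf_jordan mu)) RintegralMB//.
  rewrite /primitive (prim_weak hab (integrable_cst1 jp) tphi)
    (prim_weak hab (integrable_cst1 jn) tphi).
  have e1 (m : {finite_measure set mR -> \bar R}) :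
      \int[m]_(x in I) (cst 1 x * phi x) = \int[m]_(x in I) phi x.
    by apply: eq_Rintegral => x _; rewrite mul1r.
  by rewrite (e1 jp) (e1 jn); lra.
have ciE phi : test_fun a b phi ->
    charge_int mu I phi = (\int[jp]_(x in I) phi x - \int[jn]_(x in I) phi x)%:E.
  move=> tphi.
  have ip (m : {finite_measure set mR -> \bar R}) : m.-integrable I (EFin \o phi).
    have := integrableMc (integrable_cst1 m) (test_fun_continuous tphi).
    by apply: eq_integrable => // x _ /=; rewrite mul1r.
  rewrite /charge_int EFinB /Rintegral !fineK//.
  - by apply: integrable_fin_num => //; exact: (ip jn).
  - by apply: integrable_fin_num => //; exact: (ip jp).
split=> H phi tphi; have := H _ tphi; rewrite key// ciE// integral_EFin//.
- by rewrite -EFinN => -[->]; rewrite addNr.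
- by move=> /eqP; rewrite addr_eq0 => /eqP ->; rewrite -EFinN.
Qed.

(** Both sides are right-continuous, so they agree at every point of [[a, b[]. At [a] this gives
    [C = C'], and elsewhere the difference of the charges satisfies [reval_eq0]. *)
Lemma cdf_uniq u C C' (mu nu : rcharge) : has_cdf u C mu -> has_cdf u C' nu ->
  C = C' /\ forall E, measurable E -> E `<=` I -> reval mu E = reval nu E.
Proof.
move=> Hm Hn.
have H : \forall x \ae lambda, I x -> C + cdf mu x = C' + cdf nu x.
  by apply: ae_mono (ae_and Hm Hn) => x [H1 H2] Ix; rewrite -H1// H2.
have cr (k : R) (m : rcharge) x : a <= x -> (fun y => k + cdf m y) @ x^'+ --> k + cdf m x.
  by move=> ax; apply: cvgD; [exact: cvg_cst|exact: cdf_cvg_right].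
have pt x : a <= x -> x < b -> C + cdf mu x = C' + cdf nu x.
  by move=> ax xb; exact: (ae_lim_right ax xb H (cr _ _ _ ax) (cr _ _ _ ax)).
have CC' : C = C' by have := pt a (lexx a) hab; rewrite !cdfa// !addr0.
split=> // E mE EI.
have := @reval_eq0 _ _ _ hab (cadd mu (copp nu)) _ E mE EI.
rewrite revalD// revalN => /(_ _)/eqP; rewrite subr_eq0 => H'; apply/eqP/H' => x.
rewrite /= in_itv/= => /andP[/ltW ax xb]; rewrite /cdf revalD// revalN.
by have := pt _ ax xb; rewrite CC' /cdf => /addrI ->; rewrite subrr.
Qed.

Lemma BVP u : BV a b u <-> L1 u /\ exists C mu, has_cdf u C mu.
Proof.
split=> -[Lu].
  by case=> mu /measure_derivP-/(_ Lu)[C H]; split => //; exists C, mu.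
by case=> C [mu H]; split => //; exists mu; apply/measure_derivP => //; exists C.
Qed.

Lemma Dmeas_cdf u : BV a b u -> exists C, has_cdf u C (Dmeas a b u).
Proof.
move=> [Lu eu]; apply/measure_derivP => //.
by rewrite /Dmeas; case: pselect => // h; exact: projT2 (cid h).
Qed.

(** This frees all computations from the choice made in [Dmeas]. *)
Lemma Dmeas_eq u C mu : L1 u -> has_cdf u C mu ->
  forall E, measurable E -> E `<=` I -> reval (Dmeas a b u) E = reval mu E.
Proof.
move=> Lu H; have [C' H'] : exists C, has_cdf u C (Dmeas a b u).
  by apply: Dmeas_cdf; apply/BVP; split => //; exists C, mu.
by have [] := cdf_uniq H' H.
Qed.

End derivatives.

(** * The functional int W(Dv) *)

Section W_algebra.
Context {R : realType}.
Implicit Types c m l : R.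

(** Here [m] stands for [Du(E)] and [l] for the length of [E]; the sum of absolute values bounds the
    share of [E] in the integral of [W(Du)] from below. *)
Lemma W_ge2 m l : 2 * `|m| <= `|m + l| + `|m - l| /\ 2 * l <= `|m + l| + `|m - l|.
Proof.
have h1 := ler_normD (m + l) (m - l).
have e1 : m + l + (m - l) = 2 * m by ring.
rewrite e1 normrM ger0_norm // in h1; split => //.
have := ler_norm (m + l); have := ler_norm (- (m - l)); rewrite normrN; lra.
Qed.

(** A convex combination of the two bounds of [W_ge2], with weights [|c| / 2] and [1 - |c| / 2]. *)
Lemma W_ge_affine c m l : `|c| <= 2 -> 
  c * m + (2 - `|c|) * l <= `|m + l| + `|m - l|.
Proof.
move=> c2; have [W1 W2] := W_ge2 m l.
have cm : c * m <= `|c| * `|m| by rewrite -normrM ler_norm.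
set W := `|m + l| + `|m - l| in W1 W2 *.
have h1 : `|c| * (2 * `|m|) <= `|c| * W by exact: ler_wpM2l.
have h2 : (2 - `|c|) * (2 * l) <= (2 - `|c|) * W by apply: ler_wpM2l => //; lra.
nra.
Qed.

(** The equality case. For [|c| < 2] the bound by [2 |m|] leaves [(2 - |c|) |m| <= (2 - |c|) l]; for
    [c = 2] or [c = - 2] the term in [l] disappears and the bound by [2 l] decides. *)
Lemma W_le_affine c m l : `|c| <= 2 -> 
  `|m + l| + `|m - l| <= c * m + (2 - `|c|) * l ->
  [/\ `|c| < 2 -> `|m| <= l, c = 2 -> l <= m & c = - 2 -> m <= - l].
Proof.
move=> c2; have [W1 W2] := W_ge2 m l => H; split.
- move=> c2'; have cm : c * m <= `|c| * `|m| by rewrite -normrM ler_norm.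
  rewrite -(ler_pM2l (_ : 0 < 2 - `|c|)); last by lra.
  by move: H W1; lra.
- by move=> ce; move: H W2; rewrite ce (ger0_norm (ler0n R 2)); lra.
- by move=> ce; move: H W2; rewrite ce normrN (ger0_norm (ler0n R 2)); lra.
Qed.

End W_algebra.

(** * Constant selections as minimality conditions, and the three possible regimes *)

Section selection.
Context {R : realType}.
Variables a b : R.
Hypothesis hab : a < b.
Notation mR := (measurableTypeR R).
Notation I := (`]a, b[%classic : set mR).
Notation lambda := (@lebesgue_measure R).
Notation rcharge := (charge mR R).
Notation cdf := (cdf a).
Notation has_cdf := (has_cdf a b).
Notation L1 := (L1 a b).
Notation BV := (BV a b).
Notation Dmeas := (Dmeas a b).
Implicit Types (u v : R -> R) (mu nu : rcharge) (E : set mR).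

Lemma L1_setT g : L1 g -> lambda.-integrable setT ((EFin \o g) \_ I).
Proof. by move=> Lg; apply: (iffLR (integrable_mkcond _ _)) => //; exact: measurable_itv. Qed.

Definition density g (Lg : L1 g) : rcharge := induced_charge (L1_setT Lg).

Lemma densityE g (Lg : L1 g) E : measurable E -> E `<=` I ->
  reval (density Lg) E = \int[lambda]_(x in E) g x.
Proof.
move=> mE EI; rewrite /reval /density/= /induced_charge/= /Rintegral; congr fine.
by rewrite -integral_mkcondr setIidl.
Qed.

Lemma itv_sub_I x : x < b -> `]a, x]%classic `<=` I.
Proof. by move=> xb; apply: subset_itvl; rewrite bnd_simp. Qed.

Lemma density_cdf g (Lg : L1 g) x : I x ->
  cdf (density Lg) x = primitive a lambda g x.
Proof.
move=> Ix; rewrite /cdf densityE//; apply: itv_sub_I.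
by move: Ix; rewrite /= in_itv => /andP[].
Qed.

(** Lebesgue measure on [I], made a charge so that it can be added to and subtracted from [Dv]. *)
Definition lamc : rcharge := density (L1_cst hab 1).

Lemma lamcE E : measurable E -> E `<=` I -> reval lamc E = fine (lambda E).
Proof. by move=> mE EI; rewrite densityE// Rintegral_cst// mul1r. Qed.

Lemma lamc_ge0 E : measurable E -> E `<=` I -> 0 <= reval lamc E.
Proof. by move=> mE EI; rewrite lamcE// fine_ge0. Qed.

Lemma lamc_I : reval lamc I = b - a.
Proof. by rewrite densityE// (Rintegral_cst_itv 1 hab) mul1r. Qed.

Lemma lamc_cdf x : I x -> cdf lamc x = x - a.
Proof.
move=> Ix; have : a < x < b by move: Ix; rewrite /= in_itv.
move=> /andP[ax xb]; rewrite /cdf lamcE//; last exact: itv_sub_I.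
by rewrite lebesgue_measure_itv/= lte_fin ax.
Qed.

Definition variation nu : R := fine (tvar nu I).

(** The variation is additive and dominates the charge on each piece. Two pieces suffice, since the
    trichotomy isolates one set [E] at a time. *)
Lemma variation_ge nu E : measurable E -> E `<=` I ->
  `|reval nu E| + `|reval nu (I `\` E)| <= variation nu.
Proof.
move=> mE EI.
pose V : rcharge := charge_variation (hahn_posneg nu).
have mIE : measurable (I `\` E) by exact: measurableD.
have h F : measurable F -> `|reval nu F| <= reval V F.
  move=> mF; rewrite -lee_fin -revalE//.
  by rewrite -abse_EFin -revalE//; exact: abse_charge_variation.
have -> : variation nu = reval V E + reval V (I `\` E).
  by rewrite reval_setD// addrC subrK.
by apply: lerD; exact: h.
Qed.

(** The negative Jordan part is minus [nu] on a subset of [I], hence vanishes whatever the Hahn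
    decomposition is. *)
Lemma variation_pos nu : (forall E, measurable E -> E `<=` I -> 0 <= reval nu E) ->
  variation nu = reval nu I.
Proof.
move=> H; set h := hahn_posneg nu.
have dI := jordan_decomp h (measurable_itv `]a, b[).
have jn0 : jordan_neg h I = 0%E.
  apply/eqP; rewrite eq_le measure_ge0 andbT.
  rewrite jordan_negE cjordan_negE /crestr0 ifT ?inE// /crestr.
  have [_ [mN _] _ _] := h.
  by rewrite revalE ?lee_fin ?oppr_le0 ?H//; apply: measurableI.
have -> : variation nu = fine (jordan_pos h I + jordan_neg h I)%E by [].
rewrite /reval dI.
have -> : cadd (jordan_pos h) (cscale (-1) (jordan_neg h)) I =
  (jordan_pos h I + (-1)%:E * jordan_neg h I)%E by [].
by rewrite jn0 mule0.
Qed.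

Lemma variation_neg nu : (forall E, measurable E -> E `<=` I -> reval nu E <= 0) ->
  variation nu = - reval nu I.
Proof.
move=> H; set h := hahn_posneg nu.
have dI := jordan_decomp h (measurable_itv `]a, b[).
have jp0 : jordan_pos h I = 0%E.
  apply/eqP; rewrite eq_le measure_ge0 andbT.
  rewrite jordan_posE cjordan_posE /crestr0 ifT ?inE// /crestr.
  have [[mP _] _ _ _] := h.
  by rewrite revalE ?lee_fin ?H//; apply: measurableI.
have -> : variation nu = fine (jordan_pos h I + jordan_neg h I)%E by [].
rewrite /reval dI.
have -> : cadd (jordan_pos h) (cscale (-1) (jordan_neg h)) I =
  (jordan_pos h I + (-1)%:E * jordan_neg h I)%E by [].
by rewrite jp0 !add0e EFinN mulN1e fineN opprK.
Qed.

Lemma has_cdfD u v C C' mu nu : has_cdf u C mu -> has_cdf v C' nu ->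
  has_cdf (fun x => u x + v x) (C + C') (cadd mu nu).
Proof.
move=> Hu Hv; apply: ae_mono (ae_and Hu Hv) => x [H1 H2] Ix.
by rewrite H1// H2// /cdf revalD//; lra.
Qed.

Lemma has_cdfN u C mu : has_cdf u C mu -> has_cdf (fun x => - u x) (- C) (copp mu).
Proof.
by apply: ae_mono => x H Ix; rewrite H// /cdf revalN opprD.
Qed.

Lemma has_cdf_id : has_cdf id a lamc.
Proof. by apply: aeW => x Ix; rewrite lamc_cdf// addrC subrK. Qed.

Lemma has_cdfDx v C mu : has_cdf v C mu ->
  has_cdf (fun x => v x + x) (C + a) (cadd mu lamc).
Proof. by move=> H; exact: has_cdfD H has_cdf_id. Qed.

Lemma has_cdfBx v C mu : has_cdf v C mu ->
  has_cdf (fun x => v x - x) (C - a) (cadd mu (copp lamc)).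
Proof. by move=> H; exact: has_cdfD H (has_cdfN has_cdf_id). Qed.

Lemma L1_id : L1 id.
Proof. by apply: L1_continuous => // x; exact: cvg_id. Qed.

Lemma Dmeas_Dx v E : BV v -> measurable E -> E `<=` I ->
  reval (Dmeas (fun x => v x + x)) E = reval (Dmeas v) E + reval lamc E.
Proof.
move=> Bv mE EI; have [Lv _] := Bv; have [C H] := Dmeas_cdf hab Bv.
rewrite (Dmeas_eq hab (L1D Lv L1_id) (has_cdfDx H))//.
by rewrite revalD.
Qed.

Lemma Dmeas_Bx v E : BV v -> measurable E -> E `<=` I ->
  reval (Dmeas (fun x => v x - x)) E = reval (Dmeas v) E - reval lamc E.
Proof.
move=> Bv mE EI; have [Lv _] := Bv; have [C H] := Dmeas_cdf hab Bv.
rewrite (Dmeas_eq hab (L1B Lv L1_id) (has_cdfBx H))//.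
by rewrite revalD// revalN.
Qed.

Definition rintW v : R :=
  variation (Dmeas (fun x => v x + x)) + variation (Dmeas (fun x => v x - x)).

Lemma intWE v : intW a b v = (rintW v)%:E.
Proof.
by rewrite /intW /rintW EFinD /variation !fineK//; apply: fin_num_measure.
Qed.

Lemma rintW_ge v E : BV v -> measurable E -> E `<=` I ->
  (`|reval (Dmeas v) E + reval lamc E| + `|reval (Dmeas v) E - reval lamc E|) +
  (`|reval (Dmeas v) (I `\` E) + reval lamc (I `\` E)| +
   `|reval (Dmeas v) (I `\` E) - reval lamc (I `\` E)|) <= rintW v.
Proof.
move=> Bv mE EI; have mIE : measurable (I `\` E) by exact: measurableD.
have IEI : I `\` E `<=` I by exact: subDsetl.
have := variation_ge (Dmeas (fun x => v x + x)) mE EI.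
have := variation_ge (Dmeas (fun x => v x - x)) mE EI.
rewrite !Dmeas_Dx// !Dmeas_Bx// /rintW; lra.
Qed.

Lemma rintW_ge_affine c v : BV v -> `|c| <= 2 ->
  c * reval (Dmeas v) I + (2 - `|c|) * (b - a) <= rintW v.
Proof.
move=> Bv c2; apply: le_trans (rintW_ge Bv (measurable_itv _) (@subset_refl _ I)).
by rewrite setDv !reval0 addr0 subr0 normr0 !addr0 lamc_I; exact: W_ge_affine.
Qed.

(** Both [Dv + dx] and [Dv - dx] are nonnegative, so their variations are their masses and [dx]
    cancels in the sum. *)
Lemma rintW_pos v : BV v ->
  (forall E, measurable E -> E `<=` I -> reval lamc E <= reval (Dmeas v) E) ->
  rintW v = 2 * reval (Dmeas v) I.
Proof.
move=> Bv H; rewrite /rintW !variation_pos ?Dmeas_Dx ?Dmeas_Bx//.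
- lra.
- by move=> E mE EI; rewrite Dmeas_Bx// subr_ge0 H.
- move=> E mE EI; rewrite Dmeas_Dx// addr_ge0 ?lamc_ge0//.
  by rewrite (le_trans _ (H _ _ _))// lamc_ge0.
Qed.

Lemma rintW_neg v : BV v ->
  (forall E, measurable E -> E `<=` I -> reval (Dmeas v) E <= - reval lamc E) ->
  rintW v = - 2 * reval (Dmeas v) I.
Proof.
move=> Bv H; rewrite /rintW !variation_neg ?Dmeas_Dx ?Dmeas_Bx//.
- lra.
- by move=> E mE EI; rewrite Dmeas_Bx//; have := H _ mE EI; have := lamc_ge0 mE EI; lra.
- by move=> E mE EI; rewrite Dmeas_Dx//; have := H _ mE EI; have := lamc_ge0 mE EI; lra.
Qed.

(** Now [Dv + dx] is nonnegative and [Dv - dx] nonpositive, so [Dv] cancels and [2 dx] remains. *)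
Lemma rintW_le1 v : BV v ->
  (forall E, measurable E -> E `<=` I -> `|reval (Dmeas v) E| <= reval lamc E) ->
  rintW v = 2 * (b - a).
Proof.
move=> Bv H; rewrite /rintW variation_pos ?variation_neg ?Dmeas_Dx ?Dmeas_Bx// ?lamc_I.
- lra.
- by move=> E mE EI; rewrite Dmeas_Bx//; have := H _ mE EI; rewrite ler_norml; lra.
- by move=> E mE EI; rewrite Dmeas_Dx//; have := H _ mE EI; rewrite ler_norml; lra.
Qed.

Lemma charge_int_cst nu (Om : R -> R) c : (forall x, I x -> Om x = c) ->
  charge_int nu I Om = (c * reval nu I)%:E.
Proof.
move=> H; rewrite /charge_int.
under eq_integral => x xI do rewrite (H x (set_mem xI)).
under [X in (_ - X)%E]eq_integral => x xI do rewrite (H x (set_mem xI)).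
rewrite !integral_cst//.
have := jordan_decomp (hahn_posneg nu) (measurable_itv `]a, b[).
rewrite /cadd/= cscaleN1 /reval => ->.
rewrite fineB; [|exact: fin_num_measure..].
by rewrite mulrBr EFinB !EFinM !fineK//; exact: fin_num_measure.
Qed.

Lemma selectionP u (Om : R -> R) c : (forall x, I x -> Om x = c) ->
  selection a b u Om <->
  forall v, BV v -> rintW u + c * (reval (Dmeas v) I - reval (Dmeas u) I) <= rintW v.
Proof.
move=> H; rewrite /selection; split => K v Bv; have := K _ Bv;
  by rewrite !intWE (charge_int_cst _ H) revalD// revalN -EFinD lee_fin.
Qed.

(** The lower bound [rintW_ge_affine] is affine in [Dv(I)] with slope [c], so a function that
    attains it satisfies the subdifferential inequality. *)
Lemma selection_suff u (Om : R -> R) c : (forall x, I x -> Om x = c) -> `|c| <= 2 ->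
  rintW u = c * reval (Dmeas u) I + (2 - `|c|) * (b - a) -> selection a b u Om.
Proof.
move=> H c2 W; apply/(selectionP _ H) => v Bv; rewrite W.
have := rintW_ge_affine Bv c2; lra.
Qed.

Lemma BV_linear (p : R) : BV (fun x => p * x) /\
  forall E, measurable E -> E `<=` I ->
    reval (Dmeas (fun x => p * x)) E = p * reval lamc E.
Proof.
have L : L1 (fun x => p * x).
  by apply: L1_continuous => // x; apply: cvgM; [exact: cvg_cst|exact: cvg_id].
have H : has_cdf (fun x => p * x) (p * a) (cscale p lamc).
  by apply: aeW => x Ix; rewrite /cdf revalZ// -/(cdf _ _) lamc_cdf//; lra.
split; first by apply/BVP => //; split => //; exists (p * a), (cscale p lamc).
by move=> E mE EI; rewrite (Dmeas_eq hab L H)// revalZ.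
Qed.

Lemma rintW_linear (p : R) : 1 <= `|p| -> rintW (fun x => p * x) = 2 * `|p| * (b - a).
Proof.
have [Bp Ep] := BV_linear p.
have [p0|p0] := leP 0 p; [rewrite ger0_norm// => p1 | rewrite ltr0_norm// => p1].
  rewrite rintW_pos// ?Ep// ?lamc_I ?mulrA// => E mE EI; rewrite Ep//.
  by rewrite ler_peMl// lamc_ge0.
rewrite rintW_neg// ?Ep// ?lamc_I; first by rewrite mulrN mulNr mulrA mulNr.
move=> E mE EI; rewrite Ep// -mulN1r ler_wpM2r ?lamc_ge0//; lra.
Qed.

Lemma selection_nec u (Om : R -> R) c : BV u -> (forall x, I x -> Om x = c) ->
  selection a b u Om -> `|c| <= 2 /\
    rintW u <= c * reval (Dmeas u) I + (2 - `|c|) * (b - a).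
Proof.
move=> Bu H /(selectionP _ H) K.
set M := reval (Dmeas u) I.
have L0 : 0 < b - a by rewrite subr_gt0.
(* Test with the linear function of slope [s * p], [s] being the sign of [c]. *)
have key p : 1 <= p -> rintW u - c * M <= (2 - `|c|) * p * (b - a).
  move=> p1; pose s : R := if 0 <= c then 1 else -1.
  have sc : c * s = `|c|.
    rewrite /s; case: ifPn => c0; first by rewrite mulr1 ger0_norm.
    by rewrite mulrN1 ltr0_norm// ltNge.
  have s1 : `|s * p| = p.
    rewrite normrM (ger0_norm (le_trans ler01 p1)) /s.
    by case: ifP; rewrite ?normrN normr1 mul1r.
  have [Bp Ep] := BV_linear (s * p).
  have := K _ Bp; rewrite Ep// rintW_linear s1// lamc_I -/M.
  by rewrite mulrBr !mulrA sc; lra.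
have c2 : `|c| <= 2.
  rewrite leNgt; apply/negP => c2.
  pose K0 := rintW u - c * M.
  have d0 : 0 < (`|c| - 2) * (b - a) by apply: mulr_gt0 => //; lra.
  (* This slope is large enough for the right-hand side of [key] to fall strictly below [- |K0|],
     hence below [K0]. *)
  have := key (1 + `|K0| / ((`|c| - 2) * (b - a))) _.
  rewrite -/K0 lerDl divr_ge0// ?(ltW d0)// => /(_ isT).
  have -> : (2 - `|c|) * (1 + `|K0| / ((`|c| - 2) * (b - a))) * (b - a) =
    - ((`|c| - 2) * (b - a)) - `|K0|.
    by field; apply/andP; split; lra.
  by have := ler_norm (- K0); rewrite normrN; lra.
(* Since [2 - |c|] is nonnegative, [p = 1] gives the sharpest of the bounds in [key]. *)
split => //; have := key 1 (lexx _); lra.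
Qed.

Lemma steady_trichotomy u (Om : R -> R) c : BV u -> (forall x, I x -> Om x = c) ->
  selection a b u Om ->
  let P (Q : R -> R -> Prop) := forall E, measurable E -> E `<=` I ->
    Q (reval (Dmeas u) E) (reval lamc E) in
  [\/ `|c| < 2 /\ P (fun m l => `|m| <= l), c = 2 /\ P (fun m l => l <= m) |
      c = - 2 /\ P (fun m l => m <= - l)].
Proof.
move=> Bu H sel P; have [c2 W] := selection_nec Bu H sel.
(* [rintW_ge] splits over [E] and [I \ E]; the affine lower bound on [I \ E]
   leaves the upper bound of [selection_nec] on [E] alone. *)
have K E : measurable E -> E `<=` I ->
    `|reval (Dmeas u) E + reval lamc E| + `|reval (Dmeas u) E - reval lamc E| <=
    c * reval (Dmeas u) E + (2 - `|c|) * reval lamc E.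
  move=> mE EI.
  have := le_trans (rintW_ge Bu mE EI) W.
  have mIE : measurable (I `\` E) by exact: measurableD.
  have := @W_ge_affine _ c (reval (Dmeas u) (I `\` E)) (reval lamc (I `\` E)) c2.
  rewrite -lamc_I !reval_setD//; lra.
have cases : [\/ `|c| < 2, c = 2 | c = - 2].
  move: c2; rewrite le_eqVlt => /predU1P[|]; last by constructor 1.
  have [c0|/ltW c0] := leP 0 c; [rewrite ger0_norm// => c2|rewrite ler0_norm// => c2].
    by constructor 2.
  by constructor 3; lra.
case: cases => cc; [constructor 1|constructor 2|constructor 3]; split => // E mE EI;
  have [h1 h2 h3] := W_le_affine c2 (K E mE EI); [exact: h1|exact: h2|exact: h3].
Qed.

(** A zero weak derivative makes [Om] constant almost everywhere, and its continuity in [I] makes it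
    constant everywhere there. Pointwise constancy matters because [Om] is integrated against
    measures that may have atoms. *)
Lemma steady_Omega_cst (Om : R -> R) : W12 a b Om -> weak_deriv a b Om (fun=> 0) ->
  exists c, forall x, I x -> Om x = c.
Proof.
move=> [cOm [mOm L2Om] _] wd.
have LOm : L1 Om.
  (* Square integrability on a bounded interval gives integrability through [|t| <= 1 + t^2]. *)
  apply: (@le_integrable _ _ _ lambda I _ _ (fun x => (1 + Om x ^+ 2)%:E)) => //.
  - exact/measurable_EFinP.
  - move=> x Ix /=; rewrite lee_fin (@ger0_norm _ (1 + _)) ?addr_ge0 ?sqr_ge0//.
    by have [? ?] := (sqr_ge0 (`|Om x| - 1), real_normK (num_real (Om x))); nra.
  - exact: (@integrableD _ _ _ lambda I _ _ _ (L1_cst hab 1) L2Om).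
have [C HC] := (weak_derivP hab LOm (L1_cst hab 0)).1 wd.
exists C => x; rewrite /= in_itv/= => /andP[ax xb].
have HC' : \forall y \ae lambda, I y -> Om y = C.
  apply: ae_mono HC => y Hy Iy; rewrite Hy// /primitive.
  by rewrite Rintegral_cst// mul0r addr0.
apply: (ae_lim_right (ltW ax) xb HC') (cvg_cst _).
apply: cvg_at_right_filter; apply: cOm; by rewrite in_itv/= ax.
Qed.

End selection.

(** * Charges from monotone functions *)

Section right_regularization.
Context {R : realType}.
Variable G : R -> R.
Hypothesis ndG : {homo G : x y / x <= y}.

Definition right_lim (x : R) : R := lim (G y @[y --> x^'+]).

Lemma right_lim_cvg x : G y @[y --> x^'+] --> right_lim x.
Proof.
apply: nondecreasing_at_right_is_cvgr.
  by apply: nearW => y z t _ _; exact: ndG.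
apply: nearW => y; exists (G x) => _ [z + <-].
by rewrite /= in_itv/= => /andP[/ltW xz _]; exact: ndG.
Qed.

Lemma left_lim_cvg x : cvg (G y @[y --> x^'-]).
Proof.
apply: nondecreasing_at_left_is_cvgr.
  by apply: nearW => y z t _ _; exact: ndG.
apply: nearW => y; exists (G x) => _ [z + <-].
by rewrite /= in_itv/= => /andP[_ /ltW xz]; exact: ndG.
Qed.

Lemma right_lim_ge x : G x <= right_lim x.
Proof.
apply: limr_ge; first exact: right_lim_cvg.
near=> y; apply/ndG/ltW; near: y; exact: nbhs_right_gt.
Unshelve. all: end_near. Qed.

Lemma right_lim_le x y : x < y -> right_lim x <= G y.
Proof.
move=> xy; apply: limr_le; first exact: right_lim_cvg.
near=> z; apply/ndG/ltW; near: z; exact: nbhs_right_lt.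
Unshelve. all: end_near. Qed.

Lemma right_lim_nd : {homo right_lim : x y / x <= y}.
Proof.
move=> x y; rewrite le_eqVlt => /predU1P[->//|xy].
exact: le_trans (right_lim_le xy) (right_lim_ge y).
Qed.

Lemma right_lim_rc x : right_lim @ x^'+ --> right_lim x.
Proof.
apply/cvgrPdist_lt => e e0.
have : \forall y \near x^'+, G y < right_lim x + e.
  by apply: (cvgr_lt (right_lim x)); [exact: right_lim_cvg|rewrite ltrDl].
case=> d /= d0 Hd; near=> z.
have xz : x < z by near: z; exact: nbhs_right_gt.
have zd : z < x + d by near: z; apply: nbhs_right_lt; rewrite ltrDl.
(* [right_lim z] is controlled by [G] only at points strictly to the right of [z]; the midpoint of
   [z] and [x + d] is one still within reach of [Hd]. *)
have : right_lim z < right_lim x + e.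
  apply: (@le_lt_trans _ _ (G ((z + (x + d)) / 2))); first by apply: right_lim_le; lra.
  by apply: Hd => /=; [rewrite ltr0_norm; lra|lra].
have := right_lim_nd (ltW xz).
by rewrite distrC => h1 h2; rewrite ger0_norm; lra.
Unshelve. all: end_near. Qed.

(** Where [G] differs from its right limit it jumps, and a monotone function has countably many
    jumps. *)
Lemma right_lim_ae : \forall x \ae (@lebesgue_measure R), right_lim x = G x.
Proof.
(* The jumps are counted on bounded intervals that exhaust the line. *)
pose D n := [set x | x \in (`](- n%:R), n%:R[) /\ discontinuity G x].
have cD : countable (\bigcup_n D n).
  apply: bigcup_countable => // n _; apply: discontinuity_countable.
  by move=> x y _ _; exact: ndG.
exists (\bigcup_n D n); split.
- by apply: countable_measurable => //; exact: measurable_set1.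
- exact: countable_lebesgue_measure0.
move=> x /= /eqP Fx; exists (Num.truncn `|x|).+1 => //; split.
  by have := truncnS_gt `|x|; rewrite ltr_norml in_itv.
split; [exact: left_lim_cvg|exact: right_lim_cvg|].
rewrite lt_eqF// (@le_lt_trans _ _ (G x))//.
  apply: limr_le; first exact: left_lim_cvg.
  near=> y; apply/ndG/ltW; near: y; exact: nbhs_left_lt.
by rewrite lt_neqAle eq_sym Fx; exact: right_lim_ge.
Unshelve. all: end_near. Qed.

End right_regularization.

Section stieltjes.
Context {R : realType}.
Variable F : R -> R.
Hypothesis ndF : {homo F : x y / x <= y}.
Hypothesis rcF : forall x, F @ x^'+ --> F x.
Definition cumulF : cumulative R R := HB.pack F (isCumulative.Build R _ R F ndF rcF).
Lemma ls_itv x y : x <= y ->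
  lebesgue_stieltjes_measure cumulF `]x, y]%classic = (F y - F x)%:E.
Proof.
move=> xy.
rewrite /lebesgue_stieltjes_measure /measure_extension measurable_mu_extE/=; last exact: is_ocitv.
by rewrite wlength_itv_bnd.
Qed.
End stieltjes.

Section monotone.
Context {R : realType}.
Variables a b : R.
Hypothesis hab : a < b.
Notation mR := (measurableTypeR R).
Notation I := (`]a, b[%classic : set mR).
Notation lambda := (@lebesgue_measure R).
Notation rcharge := (charge mR R).
Notation cdf := (cdf a).
Notation has_cdf := (has_cdf a b).

Lemma nondecreasing_has_cdf (w : R -> R) (m M : R) :
  {in `]a, b[ &, {homo w : x y / x <= y}} -> (forall x, I x -> m <= w x <= M) ->
  exists C mu, has_cdf w C mu /\
    forall E, measurable E -> E `<=` I -> 0 <= reval mu E.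
Proof.
move=> ndw bw.
(* Stieltjes measures need a right-continuous integrator on the whole line; the
   regularization changes [G] only at its countably many discontinuities. *)
pose G x := if x <= a then m else if x < b then w x else M.
have mid : m <= M.
  have /andP[h1 h2] : m <= w ((a + b) / 2) <= M.
    by apply: bw; rewrite /= in_itv/=; apply/andP; split; have := hab; lra.
  exact: le_trans h1 h2.
have GI x : I x -> G x = w x.
  by rewrite /= in_itv/= /G => /andP[ax xb]; rewrite leNgt ax xb.
have ndG : {homo G : x y / x <= y}.
  move=> x y xy; rewrite /G.
  have [xa|ax] := leP x a; have [ya|ay] := leP y a => //.
  - by case: ltP => // yb; have /andP[] : m <= w y <= M by apply: bw; rewrite /= in_itv/= ay.
  - by lra.
  - have [xb|bx] := ltP x b; have [yb|byy] := ltP y b => //.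
    + by apply: ndw => //; rewrite in_itv/= ?ax ?ay.
    + by have /andP[] : m <= w x <= M by apply: bw; rewrite /= in_itv/= ax.
    + by lra.
pose F := right_lim G.
pose LS := lebesgue_stieltjes_measure (cumulF (right_lim_nd ndG) (right_lim_rc ndG)).
(* A charge is finite, so the Stieltjes measure is restricted to [I], where its mass is at most
   [F b - F a]. *)
have LSI : (LS I < +oo)%E.
  apply: (@le_lt_trans _ _ (LS `]a, b]%classic)); last by rewrite /LS ls_itv ?ltry// ltW.
  by apply: le_measure; rewrite ?inE//; apply: subset_itvl; rewrite bnd_simp.
pose mI : measurable I := measurable_itv `]a, b[.
pose m0 : {finite_measure set mR -> \bar R} := mfrestr mI LSI.
pose mu : rcharge := charge_of_finite_measure m0.
(* [F a] is the right limit of [w] at [a], and the mass of []a, x]] is [F x - F a]. *)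
exists (F a), mu; split; last first.
  by move=> E mE EI; rewrite /reval fine_ge0//; exact: measure_ge0.
have : \forall x \ae lambda, F x = G x by exact: right_lim_ae.
apply: ae_mono => x FG Ix.
rewrite -GI// -FG /cdf /reval /mu /= /charge_of_finite_measure /= /mfrestr/= /mrestr.
rewrite setIidl; last by apply: itv_sub_I; move: Ix; rewrite /= in_itv => /andP[].
rewrite /LS ls_itv/=; first by rewrite addrC subrK.
by move: Ix; rewrite /= in_itv => /andP[/ltW].
Qed.

End monotone.

(** * Steady states *)

Section steady.
Context {R : realType}.
Variables a b : R.
Hypothesis hab : a < b.
Notation mR := (measurableTypeR R).
Notation I := (`]a, b[%classic : set mR).
Notation lambda := (@lebesgue_measure R).
Notation rcharge := (charge mR R).
Notation cdf := (cdf a).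
Notation has_cdf := (has_cdf a b).
Notation L1 := (L1 a b).
Notation BV := (BV a b).
Notation Dmeas := (Dmeas a b).
Notation lamc := (lamc hab).
Implicit Types (u v w : R -> R) (mu nu : rcharge) (E : set mR).

Lemma has_cdf_ext u v C mu : (\forall x \ae lambda, I x -> u x = v x) ->
  has_cdf v C mu -> has_cdf u C mu.
Proof.
by move=> uv; move/(ae_and uv); apply: ae_mono => x [H1 H2] Ix; rewrite H1// H2.
Qed.

Lemma BV_of_cdf u C mu : measurable_fun I u -> has_cdf u C mu -> BV u.
Proof.
move=> mu' H; apply/BVP => //; split; last by exists C, mu.
apply: (L1_ext (L1D (L1_cst hab C) (L1_cdf hab mu)) mu').
by apply: ae_mono H => x H Ix; rewrite H.
Qed.

Lemma BV_Dmeas u C mu : BV u -> has_cdf u C mu ->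
  forall E, measurable E -> E `<=` I -> reval (Dmeas u) E = reval mu E.
Proof. by case=> Lu _; exact: Dmeas_eq. Qed.

Lemma lipschitz_le k w x y : lipschitz_const a b k w -> I x -> I y ->
  `|w x - w y| <= k * `|x - y|.
Proof. by move=> H Ix Iy; exact: (H (x, y)). Qed.

Lemma lipschitz_has_cdf k w : lipschitz_const a b k w ->
  exists C mu, has_cdf w C mu /\
    forall E, measurable E -> E `<=` I -> - (k * reval lamc E) <= reval mu E.
Proof.
move=> Hw; pose x0 := (a + b) / 2.
have Ix0 : I x0 by rewrite /= in_itv/= /x0; have := hab; lra.
(* The first term bounds the oscillation of [w] around [w x0], the second bounds [k * x] on [I]. *)
pose M := `|k| * (b - a) + `|k| * (`|a| + `|b|).
have kx x : I x -> `|k * x| <= `|k| * (`|a| + `|b|).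
  rewrite /= in_itv/= => /andP[ax xb]; rewrite normrM ler_wpM2l// ler_norml.
  have := ler_norm b; have := ler_norm (- a); rewrite normrN.
  by have := normr_ge0 a; have := normr_ge0 b; lra.
have [||C [m [H m0]]] := @nondecreasing_has_cdf _ _ _ hab
  (fun x => w x + k * x) (w x0 - M) (w x0 + M).
- move=> x y xI yI xy.
  have := lipschitz_le Hw xI yI.
  rewrite (ler0_norm (_ : x - y <= 0)); last by rewrite subr_le0.
  by have := ler_norm (w x - w y); lra.
- move=> x Ix; have := lipschitz_le Hw Ix Ix0.
  have := kx _ Ix; rewrite ler_norml => kxx.
  have : k * `|x - x0| <= `|k| * (b - a).
    apply: (@le_trans _ _ (`|k| * `|x - x0|)); first by rewrite ler_wpM2r// ler_norm.
    rewrite ler_wpM2l// ler_norml; move: Ix Ix0; rewrite /= !in_itv/=; lra.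
  by rewrite ler_norml /M; lra.
have [Bk Ek] := BV_linear hab k.
exists (C - k * a), (cadd m (copp (cscale k lamc))); split.
  apply: ae_mono H => x Hx Ix; move/eqP: (Hx Ix); rewrite -subr_eq => /eqP <-.
  rewrite /cdf revalD// revalN revalZ// -!/(cdf _ _).
  by have := lamc_cdf hab Ix; rewrite /cdf => ->; lra.
move=> E mE EI; rewrite revalD// revalN revalZ// lerDr; exact: m0.
Qed.

(* The upper bound is the lower bound for [- w], since [D(- w) = - Dw] on [I]. *)
Lemma lipschitz_bound k w : lipschitz_const a b k w ->
  exists C mu, has_cdf w C mu /\
    forall E, measurable E -> E `<=` I -> `|reval mu E| <= k * reval lamc E.
Proof.
move=> Hw; have [C [mu [H Hmu]]] := lipschitz_has_cdf Hw.
have HwN : lipschitz_const a b k (fun x => - w x).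
  move=> [x y] [/= Ix Iy]; rewrite /self_sub/= -opprD normrN.
  exact: (lipschitz_le Hw Ix Iy).
have [C' [nu [H' Hnu]]] := lipschitz_has_cdf HwN.
have H'' := has_cdfN H'.
have [_ e] : C = - C' /\ forall E, measurable E -> E `<=` I -> reval mu E = reval (copp nu) E.
  apply: (cdf_uniq hab H); apply: has_cdf_ext H''.
  by apply: aeW => x _; rewrite opprK.
exists C, mu; split => // E mE EI; rewrite ler_norml Hmu//= e// revalN.
by have := Hnu _ mE EI; lra.
Qed.

(** The nondecreasing function [w x - x] has a nonnegative derivative, to which [dx] is added back.
    Its boundedness comes from the finite traces: by monotonicity, values close to the ends control
    all the others. *)
Lemma increasing_has_cdf u ua ub : has_version a b (increasing_slope_ge1 a b) u ->
  trace a b u a^'+ ua -> trace a b u b^'- ub ->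
  exists C mu, has_cdf u C mu /\
    forall E, measurable E -> E `<=` I -> reval lamc E <= reval mu E.
Proof.
move=> [mu' [w [_ ndf] uw]] [wa uwa cva] [wb uwb cvb].
have wwa : \forall x \ae lambda, I x -> w x = wa x.
  by apply: ae_mono (ae_and uw uwa) => x [H1 H2] Ix; rewrite -H1// H2.
have wwb : \forall x \ae lambda, I x -> w x = wb x.
  by apply: ae_mono (ae_and uw uwb) => x [H1 H2] Ix; rewrite -H1// H2.
have [//||C [m [H m0]]] := @nondecreasing_has_cdf _ _ _ hab
  (fun x => w x - x) (ua - 1 - b) (ub + 1 - a).
  move=> x Ix; have : a < x < b by move: Ix; rewrite /= in_itv.
  move=> /andP[ax xb]; apply/andP; split.
    (* The representative [wa] with a limit at [a] need not be [w], so a point [y < x] is sought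
       where both agree and exceed [ua - 1]; then [y < b] gives the bound. *)
    have Q : \forall y \near a^'+, ua - 1 < wa y /\ y < x.
      near=> y; split; near: y; last exact: nbhs_right_lt.
      by apply: (cvgr_gt ua) => //; rewrite gtrDl ltrN10.
    have [y [Iy wy [ay yx]]] := ae_near_right (lexx a) hab wwa Q.
    have : w y - y <= w x - x by apply: ndf => //; exact: ltW.
    have : y < b by move: Iy; rewrite /= in_itv => /andP[].
    by rewrite wy; lra.
  have Q : \forall y \near b^'-, wb y < ub + 1 /\ x < y.
    near=> y; split; near: y; last exact: nbhs_left_gt.
    by apply: (cvgr_lt ub) => //; rewrite ltrDl.
  have [y [Iy wy [ay yx]]] := ae_near_left hab (lexx b) wwb Q.
  have : w x - x <= w y - y by apply: ndf => //; exact: ltW.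
  have : a < y by move: Iy; rewrite /= in_itv => /andP[].
  by rewrite wy; lra.
exists (C + a), (cadd m lamc); split; last first.
  by move=> E mE EI; rewrite revalD// lerDr m0.
apply: (has_cdf_ext uw); apply: has_cdf_ext (has_cdfDx hab H).
by apply: aeW => x _; rewrite subrK.
Unshelve. all: end_near. Qed.

Lemma W12_cst c : W12 a b (fun=> c).
Proof.
split.
- by move=> x _; exact: cvg_cst.
- by split => //; exact: (L1_cst hab (c ^+ 2)).
- exists (fun=> 0); first by split => //; exact: (L1_cst hab (0 ^+ 2)).
  apply/weak_derivP => //; [exact: L1_cst|exact: L1_cst|].
  exists c; apply: aeW => x Ix.
  by rewrite /primitive Rintegral_cst// mul0r addr0.
Qed.

Lemma weak_deriv_cst c : weak_deriv a b (fun=> c) (fun=> 0).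
Proof.
apply/weak_derivP => //; [exact: L1_cst|exact: L1_cst|].
exists c; apply: aeW => x Ix.
by rewrite /primitive Rintegral_cst// mul0r addr0.
Qed.

Lemma trace_cst (c : R) (F : set_system R) {FF : Filter F} : trace a b (fun=> c) F c.
Proof. by exists (fun=> c); [exact: aeW|exact: cvg_cst]. Qed.

Lemma steady_cst u c (bc : (R -> R) -> (R -> R) -> Prop) : BV u -> `|c| <= 2 ->
  rintW a b u = c * reval (Dmeas u) I + (2 - `|c|) * (b - a) -> bc u (fun=> c) ->
  steady_state a b bc u.
Proof.
move=> Bu c2 W bcu; split => //; exists (fun=> c); split => //.
- exact: W12_cst.
- exact: weak_deriv_cst.
- exact: (selection_suff hab _ c2).
Qed.

Lemma steady_le1 u C mu bc : measurable_fun I u -> has_cdf u C mu ->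
  (forall E, measurable E -> E `<=` I -> `|reval mu E| <= reval lamc E) ->
  bc u (fun=> 0) -> steady_state a b bc u.
Proof.
move=> mu' H Hmu bcu; have Bu := BV_of_cdf mu' H.
apply: (@steady_cst u 0) => //; rewrite ?normr0//.
rewrite (rintW_le1 (hab:=hab))//; first by rewrite mul0r add0r subr0.
by move=> E mE EI; rewrite (BV_Dmeas Bu H)// Hmu.
Qed.

Lemma steady_ge1 u C mu bc : measurable_fun I u -> has_cdf u C mu ->
  (forall E, measurable E -> E `<=` I -> reval lamc E <= reval mu E) ->
  bc u (fun=> 2) -> steady_state a b bc u.
Proof.
move=> mu' H Hmu bcu; have Bu := BV_of_cdf mu' H.
apply: (@steady_cst u 2) => //; rewrite ger0_norm//.
rewrite (rintW_pos (hab:=hab))//; first by rewrite subrr mul0r addr0.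
by move=> E mE EI; rewrite (BV_Dmeas Bu H)// Hmu.
Qed.

Lemma steady_leN1 u C mu bc : measurable_fun I u -> has_cdf u C mu ->
  (forall E, measurable E -> E `<=` I -> reval mu E <= - reval lamc E) ->
  bc u (fun=> - 2) -> steady_state a b bc u.
Proof.
move=> mu' H Hmu bcu; have Bu := BV_of_cdf mu' H.
apply: (@steady_cst u (- 2)) => //; rewrite normrN ger0_norm//.
rewrite (rintW_neg (hab:=hab))//; first by rewrite subrr mul0r addr0.
by move=> E mE EI; rewrite (BV_Dmeas Bu H)// Hmu.
Qed.

Lemma steady_structure u bc : steady_state a b bc u ->
  exists Om c C mu, [/\ measurable_fun I u /\ L1 u, has_cdf u C mu, bc u Om,
    forall x, I x -> Om x = c &
    let P (Q : R -> R -> Prop) := forall E, measurable E -> E `<=` I ->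
      Q (reval mu E) (reval lamc E) in
    [\/ `|c| < 2 /\ P (fun m l => `|m| <= l), c = 2 /\ P (fun m l => l <= m) |
      c = - 2 /\ P (fun m l => m <= - l)]].
Proof.
move=> [Bu [Om [W wd sel bcu]]].
have [c Hc] := steady_Omega_cst hab W wd.
have [C H] := Dmeas_cdf hab Bu; have [Lu _] := Bu.
exists Om, c, C, (Dmeas u); split => //; first by split => //; exact: L1_measurable Lu.
exact: (steady_trichotomy hab Bu Hc sel).
Qed.

Lemma trace_Omega_a (Om : R -> R) c l : (forall x, I x -> Om x = c) ->
  trace a b Om a^'+ l -> l = c.
Proof.
move=> H; apply: (@trace_unique_a _ _ _ hab Om (fun=> c)); last exact: cvg_cst.
exact: aeW.
Qed.

Lemma trace_Omega_b (Om : R -> R) c l : (forall x, I x -> Om x = c) ->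
  trace a b Om b^'- l -> l = c.
Proof.
move=> H; apply: (@trace_unique_b _ _ _ hab Om (fun=> c)); last exact: cvg_cst.
exact: aeW.
Qed.

(** A deficit of [mu] on []a, x]] would have to be compensated on the rest of [I], where [mu] is
    dominated too. *)
Lemma cdf_eq_of_le mu nu :
  (forall E, measurable E -> E `<=` I -> reval mu E <= reval nu E) ->
  reval nu I <= reval mu I -> forall x, I x -> cdf mu x = cdf nu x.
Proof.
move=> H HI x Ix; have sub : `]a, x]%classic `<=` I.
  by apply: itv_sub_I; move: Ix; rewrite /= in_itv => /andP[].
have h1 := H `]a, x]%classic (measurable_itv _) sub.
have := H (I `\` `]a, x]) (measurableD (measurable_itv _) (measurable_itv _)) (@subDsetl _ _ _).
rewrite !reval_setD// => h2; apply/eqP; rewrite eq_le h1 /= /cdf.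
by move: h2 HI; lra.
Qed.

(* The intersections with [I] matter for [y = b] only: [mu] carries no
   information on Borel sets that are not contained in [I]. *)
Lemma cdf_lipschitz mu x y :
  (forall E, measurable E -> E `<=` I -> `|reval mu E| <= reval lamc E) ->
  a <= x -> x <= y -> y <= b ->
  `|reval mu (`]a, y] `&` I) - reval mu (`]a, x] `&` I)| <= y - x.
Proof.
move=> H ax xy yb.
have mI z : measurable (`]a, z]%classic `&` I) by exact: measurableI.
have sub : (`]a, x] `&` I) `<=` (`]a, y] `&` I).
  by apply: setSI; apply: subset_itvl; rewrite bnd_simp.
rewrite -(reval_setD _ (mI x) (mI y) sub).
apply: (le_trans (H _ (measurableD (mI y) (mI x)) _)).
  by move=> t [[_ It] _].
rewrite (reval_setD _ (mI x) (mI y) sub).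
have lE z : a <= z -> z <= b -> reval lamc (`]a, z] `&` I) = z - a.
  move=> az zb.
  have [zb'|] := ltP z b; last first.
    move=> bz; have -> : z = b by apply/eqP; rewrite eq_le zb bz.
    by rewrite setIidr ?lamc_I//; apply: subset_itvl; rewrite bnd_simp.
  rewrite setIidl; last exact: itv_sub_I.
  have [->|] := eqVneq z a; first by rewrite set_itvoc0 reval0 subrr.
  move=> za; apply: (lamc_cdf hab); rewrite /= in_itv/= zb' andbT lt_neqAle eq_sym za.
  exact: az.
rewrite (lE y (le_trans ax xy) yb) (lE x ax (le_trans xy yb)); lra.
Qed.

End steady.

(** * From bounds on the derivative measure to slopes and Lipschitz representatives *)

Section slope.
Context {R : realType}.
Variables a b : R.
Hypothesis hab : a < b.
Notation mR := (measurableTypeR R).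
Notation I := (`]a, b[%classic : set mR).
Notation lambda := (@lebesgue_measure R).
Notation rcharge := (charge mR R).
Notation cdf := (cdf a).
Notation has_cdf := (has_cdf a b).
Notation L1 := (L1 a b).
Notation lamc := (lamc hab).
Implicit Types (u v w : R -> R) (mu nu : rcharge) (E : set mR).

(** On the set where [g > 1], the function [g - 1] is positive with nonpositive integral, so this
    set is null. *)
Lemma ae_le1_of_integral (g : R -> R) : L1 g ->
  (forall E, measurable E -> E `<=` I ->
     \int[lambda]_(x in E) g x <= reval lamc E) ->
  \forall x \ae lambda, I x -> g x <= 1.
Proof.
move=> Lg H; pose E : set mR := I `&` g @^-1` `]1, +oo[.
have EI : E `<=` I by exact: subIsetl.
have mE : measurable E.
  by apply: (L1_measurable Lg); [exact: measurable_itv|exact: measurable_itv].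
have ig : lambda.-integrable E (EFin \o g) by exact: integrableS Lg.
have i1 : lambda.-integrable E (EFin \o (fun=> 1)) by exact: integrableS (L1_cst hab 1).
have g1 x : E x -> 0 <= g x - 1.
  by case=> _; rewrite /= in_itv/= andbT subr_ge0 => /ltW.
have int0 : \int[lambda]_(x in E) (g x - 1) = 0.
  apply/eqP; rewrite eq_le Rintegral_ge0// andbT RintegralB// subr_le0.
  by have := H _ mE EI; rewrite /lamc densityE.
have : (\int[lambda]_(x in E) `|(g x - 1)%:E| = 0)%E.
  transitivity (\int[lambda]_(x in E) (g x - 1)%:E)%E.
    by apply: eq_integral => x /set_mem Ex; rewrite /= ger0_norm ?g1.
  rewrite -[LHS]fineK; first by rewrite -[fine _]/(\int[lambda]_(x in E) (g x - 1)) int0.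
  by apply: integrable_fin_num => //; exact: (@integrableB _ _ _ lambda E _ _ _ ig i1).
move/ae_eq_integral_abs => /(_ mE) K.
have mg1 : measurable_fun E (fun x => (g x - 1)%:E).
  apply/measurable_EFinP; apply: measurable_funB => //.
  by case/integrableP: ig => /measurable_EFinP.
apply: ae_mono (K mg1) => x Kx Ix; rewrite leNgt; apply/negP => gx.
have Ex : E x by split => //=; rewrite in_itv/= gx.
by have := Kx Ex => /= -[]/eqP; rewrite subr_eq0 => /eqP g1x; rewrite g1x ltxx in gx.
Qed.

(** Domination by [dx] gives absolute continuity, and the Radon-Nikodym density is the weak
    derivative. *)
Lemma slope_le1_of_cdf u C mu : L1 u -> has_cdf u C mu ->
  (forall E, measurable E -> E `<=` I -> `|reval mu E| <= reval lamc E) ->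
  slope_le1 a b u.
Proof.
move=> Lu H Hmu.
have mI : measurable I := measurable_itv `]a, b[.
(* The bound says nothing outside [I], where [mu] could be singular; restricting it to [I] restores
   absolute continuity. *)
pose nu : rcharge := crestr0 mu mI.
have nuE A : measurable A -> nu A = (reval mu (A `&` I))%:E.
  move=> mA; rewrite /nu /= /crestr0 ifT ?inE// /crestr revalE//.
  exact: measurableI.
have dom : nu `<< lambda.
  apply/null_content_dominatesP => A mA A0; rewrite nuE//.
  have mAI : measurable (A `&` I) by exact: measurableI.
  have AI : A `&` I `<=` I by exact: subIsetr.
  have l0 : lambda (A `&` I) = 0%E.
    by apply: (subset_measure0 _ mA) => //; exact: subIsetl.
  have := Hmu _ mAI AI; rewrite lamcE// l0 normr_le0 => /eqP ->; done.
pose f := Radon_Nikodym nu lambda.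
pose g x := fine (f x).
have fg : f = EFin \o g.
  by apply/funext => x; rewrite /= /g fineK//; exact: Radon_Nikodym_fin_num.
have Lg : L1 g.
  rewrite /Defs.L1 -fg; apply: (integrableS measurableT) => //.
  exact: Radon_Nikodym_integrable.
have gE E : measurable E -> E `<=` I -> \int[lambda]_(x in E) g x = reval mu E.
  move=> mE EI; rewrite /Rintegral.
  have := Radon_Nikodym_integral dom mE; rewrite -/f fg nuE// setIidl// => E1.
  by rewrite -E1.
have LNg : L1 (fun x => - g x).
  rewrite (_ : (fun x => - g x) = (fun x => 0 - g x)).
    exact: L1B (L1_cst hab 0) Lg.
  by apply/funext => x; rewrite sub0r.
exists g; split => //.
  apply/weak_derivP => //; exists C.
  apply: ae_mono H => x Hx Ix; rewrite Hx// /cdf -gE//.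
  by apply: itv_sub_I; move: Ix; rewrite /= in_itv => /andP[].
have h1 : \forall x \ae lambda, I x -> g x <= 1.
  apply: ae_le1_of_integral => // E mE EI; rewrite gE//.
  by apply: le_trans (Hmu _ mE EI); exact: ler_norm.
have h2 : \forall x \ae lambda, I x -> - g x <= 1.
  apply: ae_le1_of_integral => // E mE EI.
  have -> : \int[lambda]_(x in E) (- g x) = - reval mu E.
    rewrite -gE// -mulN1r -RintegralZl//; last exact: integrableS Lg.
    by apply: eq_Rintegral => x _; rewrite mulN1r.
  by apply: le_trans (Hmu _ mE EI); rewrite -normrN ler_norm.
by apply: ae_mono (ae_and h1 h2) => x [H1 H2] Ix; rewrite ler_norml H1//; have := H2 Ix; lra.
Qed.

Lemma cdf_of_slope_le1 u : L1 u -> slope_le1 a b u ->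
  exists C mu, has_cdf u C mu /\
    forall E, measurable E -> E `<=` I -> `|reval mu E| <= reval lamc E.
Proof.
move=> Lu [g [Lg wd g1]].
have [C HC] := (weak_derivP hab Lu Lg).1 wd.
exists C, (density Lg); split.
  by apply: ae_mono HC => x Hx Ix; rewrite Hx// density_cdf.
move=> E mE EI; rewrite /lamc !densityE//.
have iE : lambda.-integrable E (EFin \o g) by exact: integrableS Lg.
apply: (le_trans (le_normr_Rintegral mE iE)).
have iE' := integrable_norm iE.
have i1 : lambda.-integrable E (EFin \o (fun=> 1)) by exact: integrableS (L1_cst hab 1).
rewrite /Rintegral fine_le//; [exact: integrable_fin_num|exact: integrable_fin_num|].
apply: ae_ge0_le_integral => //.
- by case/integrableP: iE'.
- by apply: ae_mono g1 => x Hx Ex; rewrite lee_fin Hx//; exact: EI.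
Qed.

Lemma lipschitz_version u C mu : measurable_fun I u -> has_cdf u C mu ->
  (forall E, measurable E -> E `<=` I -> `|reval mu E| <= reval lamc E) ->
  has_version a b (lipschitz_const a b 1) u.
Proof.
move=> mu' H Hmu; split => //; exists (fun x => C + cdf mu x) => //.
have key x y : I x -> I y -> x <= y -> `|cdf mu y - cdf mu x| <= y - x.
  rewrite /= !in_itv/= => /andP[ax xb] /andP[ay yb] xy.
  have := cdf_lipschitz Hmu (ltW ax) xy (ltW yb).
  by rewrite !setIidl//; exact: itv_sub_I.
move=> [x y] [/= Ix Iy]; rewrite /self_sub/= mul1r.
rewrite (_ : C + cdf mu x - (C + cdf mu y) = cdf mu x - cdf mu y); last by ring.
have [xy|/ltW yx] := leP x y.
  by rewrite distrC (le_trans (key _ _ Ix Iy xy))// -normrN opprB ler_norm.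
by rewrite (le_trans (key _ _ Iy Ix yx))// ler_norm.
Qed.

(** The zero total mass makes the continuous representative take equal values at [a] and [b], so its
    copies on successive periods fit together. *)
Lemma periodic_version u C mu : measurable_fun I u -> has_cdf u C mu ->
  (forall E, measurable E -> E `<=` I -> `|reval mu E| <= reval lamc E) ->
  reval mu I = 0 ->
  has_version a b (periodic_lipschitz_const a b 1) u.
Proof.
move=> mu' H Hmu mu0; split => //.
pose T := b - a.
have T0 : 0 < T by rewrite subr_gt0.
(* The intersection with [I] gives [f b = C + mu I], free of any mass of [mu] at [b]. *)
pose f x := C + reval mu (`]a, x] `&` I).
(* The index of the period containing [x]: subtracting [n x] periods brings [x] into [[a, b[]. *)
pose n x := (Num.floor ((x - a) / T))%:~R : R.
pose w x := f (x - T * n x).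
have nP x : a <= x - T * n x < b.
  have /andP[] := floor_itv ((x - a) / T).
  by rewrite ler_pdivlMr// ltr_pdivrMr// intrD -/(n x) /T; lra.
have fE x y : a <= x -> x <= y -> y <= b -> `|f y - f x| <= y - x.
  move=> ax xy yb; apply: le_trans (cdf_lipschitz Hmu ax xy yb).
  by rewrite /f opprD addrACA subrr add0r.
have fab : f b = f a.
  by rewrite /f setIidr ?mu0 ?set_itvoc0 ?set0I ?reval0//; apply: subset_itvl; rewrite bnd_simp.
have key x y : x <= y -> `|w y - w x| <= y - x.
  move=> xy; have nxy : n x <= n y.
    by rewrite /n ler_int le_floor// ler_pM2r ?invr_gt0// lerB.
  have /andP[ax xb] := nP x; have /andP[ay yb] := nP y.
  have [nE|nN] := eqVneq (n x) (n y).
    have := fE (x - T * n x) (y - T * n y) ax _ (ltW yb); rewrite /w nE lerD2r => /(_ xy); lra.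
  (* In different periods, the path goes from [x] to the end of its period and from the start of the
     period of [y] to [y]. The two lengths add up to at most [y - x], and [f b = f a] joins them. *)
  have n1 : n x + 1 <= n y.
    rewrite /n -[1]/(1%:~R) -intrD ler_int lezD1 lt_neqAle -(eqr_int R) nN.
    by move: nxy; rewrite /n ler_int.
  have h1 := fE _ _ ax (ltW xb) (lexx b).
  have h2 := fE _ _ (lexx a) ay (ltW yb).
  have Tn : T * (n x + 1) <= T * n y by rewrite ler_pM2l.
  have tri : `|w y - w x| <= `|w y - f a| + `|f b - w x|.
    by rewrite fab; exact: ler_distD.
  move: tri h1 h2; rewrite /w; move: Tn; rewrite mulrDr mulr1 {2}/T; lra.
exists w; first split.
- move=> x; rewrite /w /n -/T.
  have -> : (x + T - a) / T = (x - a) / T + 1%:~R by field; rewrite gt_eqF.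
  rewrite floorDrz ?rpred1// floor1 intrD; congr f; lra.
- move=> [x y] _; rewrite /self_sub/= mul1r.
  have [xy|/ltW yx] := leP x y.
    by rewrite distrC (le_trans (key _ _ xy))// -normrN opprB ler_norm.
  by rewrite (le_trans (key _ _ yx))// ler_norm.
- apply: ae_mono H => x Hx Ix; rewrite Hx// /w.
  have : a < x < b by move: Ix; rewrite /= in_itv.
  move=> /andP[ax xb].
  have -> : n x = 0.
    rewrite /n (@floor_def _ _ 0)// add0r divr_ge0 ?subr_ge0 ?ltW//=.
    by rewrite ltr_pdivrMr// mul1r /T; lra.
  by rewrite mulr0 subr0 /f setIidl//; exact: itv_sub_I.
Qed.

End slope.

(** * The Neumann, periodic and Dirichlet boundary conditions *)

Section cases.
Context {R : realType}.
Variables a b : R.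
Hypothesis hab : a < b.
Notation mR := (measurableTypeR R).
Notation I := (`]a, b[%classic : set mR).
Notation lambda := (@lebesgue_measure R).
Notation rcharge := (charge mR R).
Notation cdf := (cdf a).
Notation has_cdf := (has_cdf a b).
Notation L1 := (L1 a b).
Notation lamc := (lamc hab).
Implicit Types (u v w : R -> R) (mu nu : rcharge) (E : set mR).

Lemma neumann_slope_le1 u : steady_state a b (neumann a b) u ->
  slope_le1 a b u /\ has_version a b (lipschitz_const a b 1) u.
Proof.
move=> /(steady_structure hab)[Om [c [C [mu [[mu' Lu] H [ta _] Hc Hmu]]]]].
have c0 : c = 0 by rewrite (trace_Omega_a hab Hc ta).
have bound : forall E, measurable E -> E `<=` I -> `|reval mu E| <= reval lamc E.
  case: Hmu => -[ce //]; rewrite c0 in ce.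
    by have := ltr0Sn R 1; rewrite -ce ltxx.
  by move/eqP: ce; rewrite eq_sym oppr_eq0 pnatr_eq0.
by split; [exact: slope_le1_of_cdf Lu H bound|exact: lipschitz_version mu' H bound].
Qed.

Lemma neumann_of_lipschitz u : has_version a b (lipschitz_const a b 1) u ->
  steady_state a b (neumann a b) u.
Proof.
move=> [mu' [w Hw uw]]; have [C [mu [H Hmu]]] := lipschitz_bound hab Hw.
apply: (steady_le1 (hab:=hab) mu' (has_cdf_ext uw H)); last by split; exact: trace_cst.
by move=> E mE EI; have := Hmu E mE EI; rewrite mul1r.
Qed.

Lemma periodic_slope_le1 u : steady_state a b (periodic_bc a b) u ->
  slope_le1 a b u /\ has_version a b (periodic_lipschitz_const a b 1) u.
Proof.
move=> /(steady_structure hab)[Om [c [C [mu [[mu' Lu] H [l ta tb] Hc Hmu]]]]].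
have muI : reval mu I = 0.
  have := has_cdf_trace_b hab H tb; rewrite (has_cdf_trace_a hab H ta); lra.
have bound : forall E, measurable E -> E `<=` I -> `|reval mu E| <= reval lamc E.
  (* The condition does not fix [c], but [c = 2] and [c = - 2] would require a total mass of modulus
     at least [b - a], whereas it is zero. *)
  case: Hmu => -[_ //] /(_ I (measurable_itv _) (@subset_refl _ I));
    rewrite muI lamc_I; have := hab; lra.
by split; [exact: slope_le1_of_cdf Lu H bound|exact: periodic_version mu' H bound muI].
Qed.

(** The Lipschitz representative, with any constant, supplies integrability; the bound by [dx] comes
    from [slope_le1]. With the data attained, the selection [0] satisfies the boundary condition. *)
Lemma dirichlet_lipschitz (A B : R) u :
  (exists k, has_version a b (lipschitz_const a b k) u) ->
  slope_le1 a b u -> trace a b u a^'+ A -> trace a b u b^'- B ->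
  steady_state a b (dirichlet a b A B) u.
Proof.
move=> [k [mu' [w Hw uw]]] sl ta tb.
have [C [mu [H _]]] := lipschitz_bound hab Hw.
have [Lu _] := BV_of_cdf hab mu' (has_cdf_ext uw H).
have [C' [nu [H' Hnu]]] := cdf_of_slope_le1 hab Lu sl.
apply: (steady_le1 (hab:=hab) mu' H' Hnu); exists A, B, 0, 0; split.
- by split => //; exact: trace_cst.
- by constructor 1.
- by constructor 1.
Qed.

(** The selection [2] is the value that the boundary condition demands where the trace overshoots at
    [a] or falls short at [b]. *)
Lemma dirichlet_increasing (A B : R) u :
  has_version a b (increasing_slope_ge1 a b) u ->
  forall ua ub : R, trace a b u a^'+ ua -> trace a b u b^'- ub ->
  A <= ua -> ub <= B -> steady_state a b (dirichlet a b A B) u.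
Proof.
move=> vu ua ub ta tb Aua ubB; have [mu' _] := vu.
have [C [mu [H Hmu]]] := increasing_has_cdf hab vu ta tb.
apply: (steady_ge1 (hab:=hab) mu' H Hmu); exists ua, ub, 2, 2; split.
- by split => //; exact: trace_cst.
- by move: Aua; rewrite le_eqVlt => /predU1P[->|?]; [constructor 1|constructor 2].
- by move: ubB; rewrite le_eqVlt => /predU1P[->|?]; [constructor 1|constructor 3].
Qed.

Lemma traceN u (F : set_system R) (l : R) : Filter F -> trace a b u F l ->
  trace a b (fun x => - u x) F (- l).
Proof.
move=> FF [w uw wl]; exists (fun x => - w x); last exact: cvgN.
by apply: ae_mono uw => x H Ix; rewrite H.
Qed.

Lemma dirichlet_decreasing (A B : R) u :
  has_version a b (increasing_slope_ge1 a b) (fun x => - u x) ->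
  forall ua ub : R, trace a b u a^'+ ua -> trace a b u b^'- ub ->
  ua <= A -> B <= ub -> steady_state a b (dirichlet a b A B) u.
Proof.
move=> vu ua ub ta tb Aua ubB; have [mNu _] := vu.
have mu' : measurable_fun I u.
  have -> : u = (fun x => - - u x) by apply/funext => x; rewrite opprK.
  exact: measurableT_comp mNu.
have [C [mu [H Hmu]]] := increasing_has_cdf hab vu (traceN _ ta) (traceN _ tb).
have H' : has_cdf u (- C) (copp mu).
  by apply: has_cdf_ext (has_cdfN H); apply: aeW => x _; rewrite opprK.
apply: (steady_leN1 (hab:=hab) mu' H').
  by move=> E mE EI; rewrite revalN lerN2 Hmu.
exists ua, ub, (- 2), (- 2); split.
- by split => //; exact: trace_cst.
- by move: Aua; rewrite le_eqVlt => /predU1P[->|?]; [constructor 1|constructor 3].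
- by move: ubB; rewrite le_eqVlt => /predU1P[->|?]; [constructor 1|constructor 2].
Qed.

Lemma trace_continuous (f : R -> R) (x : R) :
  continuous f -> trace a b f x^'+ (f x) /\ trace a b f x^'- (f x).
Proof.
move=> cf; split; exists f; try exact: aeW.
  by apply: cvg_at_right_filter; exact: cf.
by apply: cvg_at_left_filter; exact: cf.
Qed.

Lemma divr_eq1 (p : R) : p / (b - a) = 1 -> p = b - a.
Proof.
by move/(congr1 ( *%R^~ (b - a))); rewrite divfK ?mul1r// subr_eq0 gt_eqF.
Qed.

Lemma dirichlet_affine (A B : R) : (B - A) / (b - a) = 1 ->
  steady_state a b (dirichlet a b A B) (fun x => x + A - a).
Proof.
move=> AB; have BA := divr_eq1 AB.
have cf : continuous (fun x : R => x + A - a).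
  by move=> x; apply: cvgB; [apply: cvgD; [exact: cvg_id|exact: cvg_cst]|exact: cvg_cst].
have [ta _] := trace_continuous a cf; have [_ tb] := trace_continuous b cf.
apply: (dirichlet_increasing _ ta tb); last 2 first.
- by lra.
- by lra.
split; first by apply: measurable_funTS; apply: continuous_measurable_fun; exact: cf.
exists (fun x => x + A - a); last exact: aeW.
by split => x y _ _ xy; lra.
Qed.

Lemma dirichlet_affineN (A B : R) : (A - B) / (b - a) = 1 ->
  steady_state a b (dirichlet a b A B) (fun x => - x + A + a).
Proof.
move=> AB; have BA := divr_eq1 AB.
have cf : continuous (fun x : R => - x + A + a).
  move=> x; apply: cvgD; last exact: cvg_cst.
  by apply: cvgD; [apply: cvgN; exact: cvg_id|exact: cvg_cst].
have [ta _] := trace_continuous a cf; have [_ tb] := trace_continuous b cf.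
apply: (dirichlet_decreasing _ ta tb); last 2 first.
- by lra.
- by lra.
split.
  apply: measurable_funTS; apply: continuous_measurable_fun => x.
  by apply: cvgN; exact: cf.
exists (fun x => - (- x + A + a)); last exact: aeW.
by split => x y _ _ xy; lra.
Qed.

(** For [|c| < 2] both data are attained, so a measure bounded by [dx] has total mass [b - a]. For
    [c = 2] the traces satisfy [A <= ua] and [ub <= B], so a measure bounded below by [dx] has mass
    at most [b - a]. In both cases it is [dx]. For [c = - 2] the mass would be at least [b - a] and
    at most [a - b]. *)
Lemma dirichlet_rigid (A B : R) u : (B - A) / (b - a) = 1 ->
  steady_state a b (dirichlet a b A B) u ->
  \forall x \ae lambda, I x -> u x = x + A - a.
Proof.
move=> /divr_eq1 BA.
move=> /(steady_structure hab)[Om [c [C [mu [_ H bc Hc Hmu]]]]].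
case: bc => ua [ub [oa [ob [[ta tb toa tob] da db]]]].
have ea := has_cdf_trace_a hab H ta; have eb := has_cdf_trace_b hab H tb.
have oac := trace_Omega_a hab Hc toa; have obc := trace_Omega_b hab Hc tob.
have L := lamc_I hab.
suff [CA K] : C = A /\ forall x, I x -> cdf mu x = cdf lamc x.
  by apply: ae_mono H => x Hx Ix; rewrite Hx// K// lamc_cdf// CA; lra.
case: Hmu => -[cc P].
- have c2 : - 2 < c /\ c < 2 by move: cc; rewrite ltr_norml => /andP[].
  have uaA : ua = A by case: da => [//|[_ e]|[_ e]]; lra.
  have ubB : ub = B by case: db => [//|[_ e]|[_ e]]; lra.
  split; first by rewrite -ea.
  apply: cdf_eq_of_le; last by lra.
  by move=> E mE EI; apply: le_trans (ler_norm _) (P E mE EI).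
- have uaA : A <= ua by case: da => [->//|[/ltW//]|[_ e]]; lra.
  have ubB : ub <= B by case: db => [->//|[_ e]|[/ltW//]]; lra.
  have muI := P I (measurable_itv _) (@subset_refl _ I).
  split; first by lra.
  have muI' : reval mu I <= reval lamc I by lra.
  by move=> x Ix; apply/esym/cdf_eq_of_le; [exact: P|exact: muI'|exact: Ix].
- have uaA : ua <= A by case: da => [->//|[_ e]|[/ltW//]]; lra.
  have ubB : B <= ub by case: db => [->//|[/ltW//]|[_ e]]; lra.
  have muI := P I (measurable_itv _) (@subset_refl _ I).
  by have := hab; lra.
Qed.

(** The same comparison with [- dx], the cases [c = 2] and [c = - 2] exchanging their roles. *)
Lemma dirichlet_rigidN (A B : R) u : (A - B) / (b - a) = 1 ->
  steady_state a b (dirichlet a b A B) u ->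
  \forall x \ae lambda, I x -> u x = - x + A + a.
Proof.
move=> /divr_eq1 AB.
move=> /(steady_structure hab)[Om [c [C [mu [_ H bc Hc Hmu]]]]].
case: bc => ua [ub [oa [ob [[ta tb toa tob] da db]]]].
have ea := has_cdf_trace_a hab H ta; have eb := has_cdf_trace_b hab H tb.
have oac := trace_Omega_a hab Hc toa; have obc := trace_Omega_b hab Hc tob.
have L := lamc_I hab.
suff [CA K] : C = A /\ forall x, I x -> cdf mu x = cdf (copp lamc) x.
  apply: ae_mono H => x Hx Ix; rewrite Hx// K// CA /cdf revalN.
  by have := lamc_cdf hab Ix; rewrite /cdf => ->; lra.
case: Hmu => -[cc P].
- have c2 : - 2 < c /\ c < 2 by move: cc; rewrite ltr_norml => /andP[].
  have uaA : ua = A by case: da => [//|[_ e]|[_ e]]; lra.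
  have ubB : ub = B by case: db => [//|[_ e]|[_ e]]; lra.
  split; first by rewrite -ea.
  have muI : reval mu I <= reval (copp lamc) I by rewrite revalN; lra.
  move=> x Ix; apply/esym/cdf_eq_of_le; [|exact: muI|exact: Ix].
  by move=> E mE EI; rewrite revalN; have := P E mE EI; rewrite ler_norml => /andP[].
- have uaA : A <= ua by case: da => [->//|[/ltW//]|[_ e]]; lra.
  have ubB : ub <= B by case: db => [->//|[_ e]|[/ltW//]]; lra.
  have muI := P I (measurable_itv _) (@subset_refl _ I).
  by have := hab; lra.
- have uaA : ua <= A by case: da => [->//|[_ e]|[/ltW//]]; lra.
  have ubB : B <= ub by case: db => [->//|[/ltW//]|[_ e]]; lra.
  have muI := P I (measurable_itv _) (@subset_refl _ I).
  split; first by lra.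
  have muI' : reval (copp lamc) I <= reval mu I by rewrite revalN; lra.
  move=> x Ix; apply: cdf_eq_of_le; [|exact: muI'|exact: Ix].
  by move=> E mE EI; rewrite revalN P.
Qed.

End cases.

Theorem proposition3p2 (R : realType) (a b : R) (hab : a < b) :
  (* (a) *)
  ((forall u, steady_state a b (neumann a b) u ->
      slope_le1 a b u /\ has_version a b (lipschitz_const a b 1) u) /\
   (forall u, has_version a b (lipschitz_const a b 1) u ->
      steady_state a b (neumann a b) u)) /\
  (* (b), case A <= B *)
  (forall A B : R, A <= B ->
    [/\ (* (i) *)
        1 < (B - A) / (b - a) ->
        forall u, has_version a b (increasing_slope_ge1 a b) u ->
        forall ua ub : R, trace a b u a^'+ ua -> trace a b u b^'- ub ->
        A <= ua -> ub <= B ->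
        steady_state a b (dirichlet a b A B) u,
        (* (ii) *)
        (B - A) / (b - a) = 1 ->
        steady_state a b (dirichlet a b A B) (fun x => x + A - a) /\
        (forall u, steady_state a b (dirichlet a b A B) u ->
          \forall x \ae (@lebesgue_measure R),
            `]a, b[%classic x -> u x = x + A - a) &
        (* (iii) *)
        (B - A) / (b - a) < 1 ->
        forall u, (exists k, has_version a b (lipschitz_const a b k) u) ->
        slope_le1 a b u -> trace a b u a^'+ A -> trace a b u b^'- B ->
        steady_state a b (dirichlet a b A B) u]) /\
  (* (b), case B <= A *)
  (forall A B : R, B <= A ->
    [/\ 1 < (A - B) / (b - a) ->
        forall u : R -> R,
        has_version a b (increasing_slope_ge1 a b) (fun x => - u x) ->
        forall ua ub : R, trace a b u a^'+ ua -> trace a b u b^'- ub ->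
        ua <= A -> B <= ub ->
        steady_state a b (dirichlet a b A B) u,
        (A - B) / (b - a) = 1 ->
        steady_state a b (dirichlet a b A B) (fun x => - x + A + a) /\
        (forall u, steady_state a b (dirichlet a b A B) u ->
          \forall x \ae (@lebesgue_measure R),
            `]a, b[%classic x -> u x = - x + A + a) &
        (A - B) / (b - a) < 1 ->
        forall u, (exists k, has_version a b (lipschitz_const a b k) u) ->
        slope_le1 a b u -> trace a b u a^'+ A -> trace a b u b^'- B ->
        steady_state a b (dirichlet a b A B) u]) /\
  (* (c) *)
  (forall u, steady_state a b (periodic_bc a b) u ->
    slope_le1 a b u /\ has_version a b (periodic_lipschitz_const a b 1) u).
Proof.
split; last split; last split.
- split; first by move=> u; exact: neumann_slope_le1.
  by move=> u; exact: neumann_of_lipschitz.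
- move=> A B _; split=> AB.
  + exact: dirichlet_increasing.
  + by split=> [|u]; [exact: dirichlet_affine|exact: dirichlet_rigid].
  + exact: dirichlet_lipschitz.
- move=> A B _; split=> AB.
  + exact: dirichlet_decreasing.
  + by split=> [|u]; [exact: dirichlet_affineN|exact: dirichlet_rigidN].
  + exact: dirichlet_lipschitz.
- by move=> u; exact: periodic_slope_le1.
Qed.
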